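(* Let $\epsilon>0$ and let $u,\theta,\psi:(-\epsilon,\epsilon)\to\mathbb R$ be differentiable functions such that $a_ju(t)+1>0$ for $j=1,\ldots,m$ and all $t\in(-\epsilon,\epsilon)$, and which satisfy \[\frac{du}{dt}=2Q(u)^{1/2}\cos\theta,\] \[\frac{d\theta}{dt}=-Q(u)^{1/2}\sin\theta\sum_{j=1}^m\frac{a_j}{a_ju+1},\] \[\frac{d\psi}{dt}=-Q(u)^{1/2}\sin\theta\sum_{j=1}^m\frac{a_j^2}{a_ju+1}.\] Define $N\subset\mathbb C^m$ to be the set of points \[\bigl(re^{i\alpha_1}\sqrt{a_1u(t)+1},\ldots,re^{i\alpha_m}\sqrt{a_mu(t)+1}\bigr)\] with $r>0$, $t\in(-\epsilon,\epsilon)$, $\alpha_j\in\mathbb R$, $\alpha_1+\cdots+\alpha_m=\theta(t)$ and $a_1\alpha_1+\cdots+a_m\alpha_m=\psi(t)$. Then $N$ is a special Lagrangian submanifold of $\mathbb C^m$ with phase $i^{m-2}$.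
   Context: Standing assumptions: $m\ge3$, and $a_1\le\cdots\le a_m$ are integers, not all zero, with highest common factor $1$ and $a_1+\cdots+a_m=0$. $Q(u)=\prod_{j=1}^m(a_ju+1)$. $\mathbb C^m$ carries the metric $g=\sum_j|dz_j|^2$, the Kähler form $\omega=\frac i2\sum_j dz_j\wedge d\bar z_j$ and $\Omega=dz_1\wedge\cdots\wedge dz_m$. An oriented real $m$-dimensional submanifold $L$ is special Lagrangian with phase $e^{i\theta}$ if $(\cos\theta\,\mathrm{Re}\,\Omega+\sin\theta\,\mathrm{Im}\,\Omega)|_L$ equals the induced volume form. *)

(* Defs.v *)
(* MathComp + MathComp-Analysis, over an abstract R : realType.
   C^m is modelled as 'M[R]_(2, m): a point P has complex coordinates
   z_j = P 0 j + i P 1 j  (row 0 = real parts, row 1 = imaginary parts).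
   Complex numbers for the holomorphic volume form come from
   mathcomp-real-closed's complex.v (R[i]). *)
From HB Require Import structures.
From mathcomp Require Import all_boot all_order all_algebra.
From mathcomp Require Import all_classical all_reals all_analysis.
From mathcomp Require Import complex.
Set Implicit Arguments. Unset Strict Implicit. Unset Printing Implicit Defensive.
Import Order.TTheory GRing.Theory Num.Theory.
Import numFieldNormedType.Exports.
Local Open Scope classical_set_scope.
Local Open Scope ring_scope.

Section Defs.
Variable R : realType.

Fixpoint iter_deriv (V W : normedModType R) (vs : seq V) (f : V -> W) : V -> W :=
  match vs with
  | [::] => f
  | v :: vs' => fun x => 'D_v (iter_deriv vs' f) x
  end.

Definition smooth_on (V W : normedModType R) (U : set V) (f : V -> W) : Prop :=
  forall vs : seq V,
    (forall x, U x -> forall v : V, derivable (iter_deriv vs f) x v) /\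
    {within U, continuous (iter_deriv vs f)}.

Definition partial (m : nat) (W : normedModType R) (f : 'rV[R]_m -> W)
  (x : 'rV[R]_m) (k : 'I_m) : W := 'D_('e_k) f x.

Definition chart (m : nat) (N : set 'M[R]_(2, m))
  (U : set 'rV[R]_m) (f : 'rV[R]_m -> 'M[R]_(2, m)) : Prop :=
  [/\ open U /\ smooth_on U f,
      (forall x, U x -> forall c : 'I_m -> R,
          \sum_(k < m) c k *: partial f x k = 0 -> forall k, c k = 0),
      (forall x y, U x -> U y -> f x = f y -> x = y),
      (exists2 W : set 'M[R]_(2, m), open W & f @` U = N `&` W) &
      (exists g : 'M[R]_(2, m) -> 'rV[R]_m,
          (forall x, U x -> g (f x) = x) /\ {within f @` U, continuous g})].

Definition ip (m : nat) (v w : 'M[R]_(2, m)) : R :=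
  \sum_(r < 2) \sum_(j < m) v r j * w r j.

Definition gram (m : nat) (F : 'I_m -> 'M[R]_(2, m)) : 'M[R]_m :=
  \matrix_(k, l) ip (F k) (F l).

(* induced volume form evaluated on a (positively oriented) frame *)
Definition vol_frame (m : nat) (F : 'I_m -> 'M[R]_(2, m)) : R :=
  Num.sqrt (\det (gram F)).

Definition dz (m : nat) (j : 'I_m) (v : 'M[R]_(2, m)) : R[i] :=
  (v 0 j +i* v 1 j)%C.

(* Omega = dz_1 /\ ... /\ dz_m evaluated on a frame *)
Definition Omega (m : nat) (F : 'I_m -> 'M[R]_(2, m)) : R[i] :=
  \det (\matrix_(k, j) dz j (F k)).

(* (cos th Re Omega + sin th Im Omega) evaluated on a frame, phase = e^{i th} *)
Definition calib (m : nat) (phase : R[i]) (F : 'I_m -> 'M[R]_(2, m)) : R :=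
  complex.Re phase * complex.Re (Omega F) + complex.Im phase * complex.Im (Omega F).

Definition same_orientation (m : nat) (F G : 'I_m -> 'M[R]_(2, m)) : Prop :=
  exists C : 'M[R]_m,
    (forall k, F k = \sum_(l < m) C k l *: G l) /\ 0 < \det C.

(* N is an (embedded, smooth) oriented m-dimensional submanifold of C^m:
   an oriented atlas, given as a family of charts indexed by a type I,
   covering N with orientation-compatible transitions; and with this
   orientation (cos th Re Omega + sin th Im Omega)|_N equals the induced
   volume form, where e^{i th} = phase. *)
Definition special_lagrangian (m : nat) (phase : R[i]) (N : set 'M[R]_(2, m))
  : Prop :=
  complex.Re phase ^+ 2 + complex.Im phase ^+ 2 = 1 /\
  exists (I : Type) (U : I -> set 'rV[R]_m) (f : I -> 'rV[R]_m -> 'M[R]_(2, m)),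
    [/\ (forall i, chart N (U i) (f i)),
        (forall p, N p -> exists i, exists2 x, U i x & f i x = p),
        (forall i i' x x', U i x -> U i' x' -> f i x = f i' x' ->
            same_orientation (partial (f i) x) (partial (f i') x')) &
        (forall i x, U i x ->
            calib phase (partial (f i) x) = vol_frame (partial (f i) x))].

Definition Qpoly (m : nat) (a : 'I_m -> int) (x : R) : R :=
  \prod_(j < m) ((a j)%:~R * x + 1).

Definition Npoint (m : nat) (a : 'I_m -> int) (r x : R) (al : 'I_m -> R)
  : 'M[R]_(2, m) :=
  \matrix_(s, j)
    (r * Num.sqrt ((a j)%:~R * x + 1) * (if s == 0 then cos (al j) else sin (al j))).

End Defs.

(* Main.v *)
(** Write v = sqrt Q cos th and A = sqrt Q sin th.  The equations become
u' = 2 v, v' = Q'(u), A' = 0, th' = - A sum a_j / (a_j u + 1) and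
ps' = - A sum a_j^2 / (a_j u + 1).  Choosing indices with a_p < 0 < a_q, N is the
image of one map in the coordinates log r, t and the angles other than the p-th and
q-th.  Differentiating z_j multiplies it by a factor depending only on (u, v, A), so
the coordinate frame depends only on the point of N; it is Lagrangian because
u ps' + th' = 0, and the determinant of its complex coordinates is i^(m-2) times a
positive real.

That the map is a homeomorphism onto its image, locally, is a statement about the
curve (u, e^(i th), e^(i ps)), an orbit of an autonomous flow.  If A = 0 then u is
strictly monotone.  If A <> 0 then Q >= A^2 makes the flow Lipschitz, and Gronwall's
inequality with the compactness of [-eps, eps] shows that a point of the orbit close
enough to the one at time t0 is also reached at a time close to t0. *)
Require Import Defs.
From HB Require Import structures.
From mathcomp Require Import all_boot all_order all_algebra.
From mathcomp Require Import all_classical all_reals all_analysis.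
From mathcomp Require Import fingroup perm complex ring lra.
Import Order.TTheory GRing.Theory Num.Theory.
Import numFieldNormedType.Exports.
Local Open Scope classical_set_scope.
Local Open Scope ring_scope.
Set Implicit Arguments. Unset Strict Implicit. Unset Printing Implicit Defensive.

(** * Derivatives, Gronwall's inequality and angles *)

(** The obstacle is that the parametrization is not injective in general: angles count modulo 2 pi
    only, and a periodic orbit meets the same point at several times. Being an injective immersion
    near each parameter is therefore not enough; a point of N close to a given one may come from a
    remote parameter, and it must be shown to come from a nearby one as well. Nothing is assumed at
    the ends of the interval, so compactness is applied to the set of times and not to the curve.
    Replacing sqrt Q cos th by v removes th from the system: A is conserved, so (u, v) determines
    e^(i th), and the equations for u, v, ps involve neither square roots nor trigonometric
    functions. This gives Lipschitz bounds once the factors a_j u + 1 stay away from 0. It also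
    gives smoothness, which is not among the hypotheses: u, v, the inverses 1/(a_j u + 1) and the
    coordinates of the point generate an algebra closed under differentiation. *)

Lemma derive_line (R : realType) (V W : normedModType R) (f : V -> W) (x w : V) :
  'D_1 (fun h : R => f (h *: w + x)) 0 = 'D_w f x.
Proof.
rewrite /derive; set g1 := fun h => h^-1 *: _; set g2 := fun h => h^-1 *: _.
suff -> : g1 = g2 by [].
by rewrite funeqE /g1 /g2 => h /=; rewrite addr0 scale0r add0r [_%:A]mulr1.
Qed.

(** Only directional derivability of [f] is assumed. Restricting to the line through [x] in
    direction [w] reduces the claim to the one-variable chain rule. *)
Lemma is_derive_compR (R : realType) (V : normedModType R) (g : R -> R)
    (f : V -> R) (x w : V) (dg df : R) :
  is_derive (f x) 1 g dg -> is_derive x w f df ->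
  is_derive x w (g \o f) (dg * df).
Proof.
move=> Dg [/derivable1P Df <-].
have Dh : is_derive (0 : R) (1 : R) (fun h : R => f (h *: w + x)) ('D_w f x).
  by split => //; rewrite derive_line.
have Dg' : is_derive ((fun h : R => f (h *: w + x)) 0) 1 g dg.
  by rewrite scale0r add0r.
have [Dc vc] := is_derive1_comp Dg' Dh.
split; first exact/derivable1P.
by rewrite -vc -derive_line.
Qed.

Lemma is_derive_coord (R : realType) (m n : nat) (x w : 'M[R]_(m, n)) i j :
  is_derive x w (fun y : 'M[R]_(m, n) => y i j) (w i j).
Proof.
have [H1] := is_derive_id x w.
rewrite derive_mx // => {2}<-.
by split; [exact: (derivable_mxP _ _ _).1|rewrite mxE].
Qed.

Lemma is_derive_mx (R : realType) (V : normedModType R) (m n : nat)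
    (f : V -> 'M[R]_(m, n)) (x w : V) (df : 'M[R]_(m, n)) :
  (forall i j, is_derive x w (fun y => f y i j) (df i j)) ->
  is_derive x w f df.
Proof.
move=> H; have d : derivable f x w by apply/derivable_mxP => i j; case: (H i j).
by split => //; rewrite derive_mx //; apply/matrixP => i j; rewrite mxE; case: (H i j).
Qed.

Lemma is_derive_continuous (R : realType) (f : R -> R) (t df : R) :
  is_derive t 1 f df -> {for t, continuous f}.
Proof. by case=> d _; exact/differentiable_continuous/derivable1_diffP. Qed.

Section OpenInterval.
Variables (R : realType) (a b : R).
Implicit Types f df : R -> R.

Lemma MVT_oo f df s t :
  (forall x, a < x < b -> is_derive x 1 f (df x)) ->
  a < s -> s < t -> t < b ->
  exists2 c, s < c < t & f t - f s = df c * (t - s).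
Proof.
move=> D as_ st tb.
have I x : s <= x <= t -> a < x < b.
  by move=> /andP[sx xt]; rewrite (lt_le_trans as_ sx) (le_lt_trans xt tb).
have [| |c] := @MVT R f df s t st.
- by move=> x; rewrite in_itv /= => /andP[sx xt]; apply/D/I; rewrite !ltW.
- apply: derivable_within_continuous => x; rewrite in_itv /= => xst.
  by case: (D x (I _ xst)).
- by move=> + ?; rewrite in_itv /= => ?; exists c.
Qed.

Lemma derive0_const f s t :
  (forall x, a < x < b -> is_derive x 1 f 0) ->
  a < s < b -> a < t < b -> f s = f t.
Proof.
move=> D; wlog st : s t / s < t.
  move=> H ls lt; case: (ltgtP s t) => [| |-> //]; first by move=> st; exact: H.
  by move=> st; apply/esym/H.
move=> /andP[as_ _] /andP[_ tb].
have [c _] := MVT_oo D as_ st tb.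
by rewrite mul0r => /eqP; rewrite subr_eq0 => /eqP.
Qed.

Lemma derive_gt0_lt f df s t :
  (forall x, a < x < b -> is_derive x 1 f (df x)) ->
  (forall x, a < x < b -> 0 < df x) ->
  a < s -> s < t -> t < b -> f s < f t.
Proof.
move=> D pos as_ st tb; have [c /andP[sc ct] e] := MVT_oo D as_ st tb.
rewrite -subr_gt0 e mulr_gt0 ?subr_gt0 // pos //.
by rewrite (lt_trans as_ sc) (lt_trans ct tb).
Qed.

Lemma derive_ge0_le f df s t :
  (forall x, a < x < b -> is_derive x 1 f (df x)) ->
  (forall x, a < x < b -> 0 <= df x) ->
  a < s -> s <= t -> t < b -> f s <= f t.
Proof.
move=> D pos as_; rewrite le_eqVlt => /predU1P[-> //|st] tb.
have [c /andP[sc ct] e] := MVT_oo D as_ st tb.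
rewrite -subr_ge0 e; apply: mulr_ge0; last by rewrite subr_ge0 ltW.
by apply: pos; rewrite (lt_trans as_ sc) (lt_trans ct tb).
Qed.

(** With integrating factors, exp(-C t) f is nonincreasing and exp(C t) f is nondecreasing, so the
    estimate holds both forward and backward in time. *)
Lemma gronwall f df (C s t : R) :
  (forall x, a < x < b -> is_derive x 1 f (df x)) ->
  (forall x, a < x < b -> `|df x| <= C * f x) ->
  a < s < b -> a < t < b -> f t <= expR (C * `|t - s|) * f s.
Proof.
move=> D bnd /andP[as_ sb] /andP[at_ tb].
have De (k x : R) : a < x < b ->
    is_derive x 1 (fun y => expR (k * y) * f y) (expR (k * x) * (df x + k * f x)).
  move=> xab; have H := D x xab.
  have H2 : is_derive x 1 (fun y => expR (k * y)) (expR (k * x) * k).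
    have : is_derive x 1 (fun y : R => k * y) k.
      by apply: is_derive_eq; rewrite /GRing.scale /=; ring.
    exact: is_derive1_comp.
  by apply: is_derive_eq; rewrite /GRing.scale /=; ring.
case: (leP s t) => st.
- have H : - (expR ((- C) * s) * f s) <= - (expR ((- C) * t) * f t).
    apply: (@derive_ge0_le (fun y => - (expR ((- C) * y) * f y))
      (fun y => - (expR ((- C) * y) * (df y + (- C) * f y))) s t _ _ as_ st tb) => x xab.
      by have ? := De (- C) x xab; exact: is_deriveN.
    rewrite -mulrN mulr_ge0 ?expR_ge0 // opprD mulNr opprK addrC subr_ge0.
    exact: le_trans (ler_norm _) (bnd x xab).
  rewrite ger0_norm ?subr_ge0 // mulrBr expRD -mulrA -mulNr.
  by rewrite -ler_pdivrMl ?expR_gt0 // -expRN -mulNr -lerN2.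
- have H : expR (C * t) * f t <= expR (C * s) * f s.
    apply: (@derive_ge0_le _ _ t s (De C) _ at_ (ltW st) sb) => x xab.
    rewrite mulr_ge0 ?expR_ge0 // -lerBlDr sub0r.
    by rewrite lerNl; apply: le_trans (bnd x xab); rewrite -normrN ler_norm.
  rewrite distrC gtr0_norm ?subr_gt0 // mulrBr expRD mulrAC.
  by rewrite expRN ler_pdivlMr ?expR_gt0 // mulrC.
Qed.

End OpenInterval.

Section TrigCongruence.
Variable R : realType.
Implicit Types x y z : R.

(** Congruence modulo 2 pi, encoded without integer multiples of pi so that the addition formulas
    apply directly. *)
Definition eqang x y := cos x = cos y /\ sin x = sin y.

Lemma eqang_refl x : eqang x x. Proof. by []. Qed.

Lemma eqang_sym x y : eqang x y -> eqang y x. Proof. by case. Qed.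

Lemma eqang_trans x y z : eqang x y -> eqang y z -> eqang x z.
Proof. by rewrite /eqang => -[-> ->] []. Qed.

Lemma eqangD x x' y y' : eqang x x' -> eqang y y' -> eqang (x + y) (x' + y').
Proof. by rewrite /eqang => -[cx sx] [cy sy]; rewrite !cosD !sinD cx sx cy sy. Qed.

Lemma eqangN x x' : eqang x x' -> eqang (- x) (- x').
Proof. by rewrite /eqang => -[cx sx]; rewrite !cosN !sinN cx sx. Qed.

(** Integrality of the weights enters here: the sum of the a_j alpha_j is well defined modulo 2 pi
    when each alpha_j is known only modulo 2 pi. *)
Lemma eqangMz (n : int) x x' : eqang x x' -> eqang (n%:~R * x) (n%:~R * x').
Proof.
move=> H; have Hn (k : nat) : eqang (k%:R * x) (k%:R * x').
  elim: k => [|k IH]; first by rewrite !mul0r.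
  by rewrite -!natr1 !mulrDl !mul1r; apply: eqangD.
case: n => k; first exact: Hn.
by rewrite NegzE !mulrNz !mulNr; apply: eqangN; exact: Hn.
Qed.

Lemma eqang_sum (I : finType) (f g : I -> R) :
  (forall i, eqang (f i) (g i)) -> eqang (\sum_i f i) (\sum_i g i).
Proof.
move=> H; apply: (big_ind2 eqang) => // x x' y y'; exact: eqangD.
Qed.

Lemma eqang_cos_sub x y : eqang x y <-> cos (x - y) = 1.
Proof.
split=> [[cx sx]|H]; first by rewrite cosB cx sx -!expr2 cos2Dsin2.
have s0 : sin (x - y) = 0 by apply/cos1sin0; rewrite H normr1.
have e : x = (x - y) + y by rewrite subrK.
by split; rewrite [in LHS]e; [rewrite cosD|rewrite sinD]; rewrite H s0; ring.
Qed.

(** The bound 2 keeps |x - y| inside [0, pi], where cos is injective. *)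
Lemma eqang_close x y : eqang x y -> `|x - y| <= 2 -> x = y.
Proof.
move=> /eqang_cos_sub c1 d2; apply/eqP; rewrite -subr_eq0 -normr_eq0; apply/eqP.
apply: (@cos_inj R); rewrite ?in_itv /= ?lexx ?pi_ge0 ?normr_ge0 //=.
  exact: le_trans d2 (pi_ge2 R).
by rewrite cos_norm c1 cos0.
Qed.

End TrigCongruence.

Lemma mul2_norm_le (R : realType) (x y : R) : 2 * `|x * y| <= x ^+ 2 + y ^+ 2.
Proof.
rewrite normrM -[x ^+ 2]real_normK ?num_real // -[y ^+ 2]real_normK ?num_real //.
by have := sqr_ge0 (`|x| - `|y|); nra.
Qed.

Lemma sqr_le_norm (R : realType) (L x y : R) : 0 <= L ->
  `|x| <= L * `|y| -> x ^+ 2 <= L ^+ 2 * y ^+ 2.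
Proof.
move=> L0 H; rewrite -[x ^+ 2]real_normK ?num_real // -[y ^+ 2]real_normK ?num_real //.
by rewrite -exprMn lerXn2r ?nnegrE ?mulr_ge0.
Qed.

(** * Bounded Lipschitz functions on a set *)

Section LipschitzBounded.
Variables (R : realType) (D : set R).

(** Boundedness is carried along with the Lipschitz estimate because products need it; one constant
    serves both. *)
Definition lipb (g : R -> R) := exists2 M : R, 0 <= M &
  forall x y, D x -> D y -> `|g x| <= M /\ `|g x - g y| <= M * `|x - y|.

Lemma lipb_cst c : lipb (fun=> c).
Proof.
by exists `|c| => // x y _ _; rewrite lexx subrr normr0; split=> //; rewrite mulr_ge0.
Qed.

Lemma lipb_id (K : R) : (forall x, D x -> `|x| <= K) -> lipb id.
Proof.
move=> H; exists (`|K| + 1); first by rewrite addr_ge0.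
move=> x y Dx _; split.
- by rewrite (le_trans (H x Dx)) // (le_trans (ler_norm K)) // lerDl.
- by rewrite ler_peMl // lerDr.
Qed.

Lemma lipbD f g : lipb f -> lipb g -> lipb (fun x => f x + g x).
Proof.
move=> [M M0 HM] [N N0 HN]; exists (M + N); first exact: addr_ge0.
move=> x y Dx Dy; have [f1 f2] := HM x y Dx Dy; have [g1 g2] := HN x y Dx Dy.
split; first by rewrite (le_trans (ler_normD _ _)) // lerD.
by rewrite opprD addrACA mulrDl (le_trans (ler_normD _ _)) // lerD.
Qed.

Lemma lipbM f g : lipb f -> lipb g -> lipb (fun x => f x * g x).
Proof.
move=> [M M0 HM] [N N0 HN]; exists (2 * M * N); first by rewrite !mulr_ge0.
move=> x y Dx Dy; have [f1 f2] := HM x y Dx Dy; have [g1 g2] := HN x y Dx Dy.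
have [f1' _] := HM y x Dy Dx.
split.
- rewrite normrM; apply: (le_trans (ler_pM _ _ f1 g1)) => //.
  by rewrite -mulrA mulr_natl mulr2n lerDl mulr_ge0.
- have -> : f x * g x - f y * g y = (f x - f y) * g x + f y * (g x - g y) by ring.
  apply: (le_trans (ler_normD _ _)); rewrite !normrM.
  have -> : 2 * M * N * `|x - y| = M * `|x - y| * N + M * (N * `|x - y|) by ring.
  by apply: lerD; apply: ler_pM.
Qed.

Lemma lipb_sum (I : finType) (f : I -> R -> R) :
  (forall i, lipb (f i)) -> lipb (fun x => \sum_i f i x).
Proof.
move=> H; elim: (index_enum I) => [|i s IH].
  by under eq_fun do rewrite big_nil; exact: lipb_cst.
by under eq_fun do rewrite big_cons; exact: lipbD.
Qed.

Lemma lipb_prod (I : finType) (P : pred I) (f : I -> R -> R) :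
  (forall i, lipb (f i)) -> lipb (fun x => \prod_(i | P i) f i x).
Proof.
move=> H; elim: (index_enum I) => [|i s IH].
  by under eq_fun do rewrite big_nil; exact: lipb_cst.
under eq_fun do rewrite big_cons; case: (P i) => //; exact: lipbM.
Qed.

Lemma lipbV f (c : R) : 0 < c -> (forall x, D x -> c <= f x) -> lipb f ->
  lipb (fun x => (f x)^-1).
Proof.
(* 1/c bounds the values and M/c^2 is the Lipschitz constant; their sum serves both. *)
move=> c0 cf [M M0 HM]; exists (c^-1 + M * c^-1 ^+ 2).
  by rewrite addr_ge0 ?mulr_ge0 ?sqr_ge0 ?invr_ge0 // ltW.
move=> x y Dx Dy; have [_ f2] := HM x y Dx Dy.
have fx := lt_le_trans c0 (cf x Dx); have fy := lt_le_trans c0 (cf y Dy).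
have ix : (f x)^-1 <= c^-1 by rewrite lef_pV2 ?posrE // cf.
have iy : (f y)^-1 <= c^-1 by rewrite lef_pV2 ?posrE // cf.
have c'0 : 0 <= c^-1 by rewrite invr_ge0 ltW.
split; first by rewrite gtr0_norm ?invr_gt0 // (le_trans ix) // lerDl mulr_ge0 ?sqr_ge0.
have -> : (f x)^-1 - (f y)^-1 = - (f x - f y) * ((f x)^-1 * (f y)^-1).
  by field; rewrite !gt_eqF.
rewrite normrM normrN mulrDl; apply: (@le_trans _ _ (M * `|x - y| * c^-1 ^+ 2)).
  have i0 z : 0 < z -> 0 <= z^-1 :> R by move=> z0; rewrite invr_ge0 ltW.
  apply: ler_pM => //; rewrite normrM !ger0_norm ?i0 //.
  by rewrite [leRHS]expr2; apply: ler_pM => //; apply: i0.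
by rewrite mulrAC lerDr mulr_ge0.
Qed.

End LipschitzBounded.

(** * Smoothness of functions in a differential algebra *)

Section ContinuousBigop.
Variables (R : realType) (T : topologicalType) (I : finType).

Lemma continuous_bigsum (f : I -> T -> R) x :
  (forall i, {for x, continuous (f i)}) ->
  {for x, continuous (fun y => \sum_i f i y)}.
Proof.
move=> H; rewrite /prop_for; elim: (index_enum I) => [|i s IH].
  by under eq_fun do rewrite big_nil; exact: cst_continuous.
by under eq_fun do rewrite big_cons; exact: continuousD.
Qed.

Lemma continuous_bigprod (f : I -> T -> R) x :
  (forall i, {for x, continuous (f i)}) ->
  {for x, continuous (fun y => \prod_i f i y)}.
Proof.
move=> H; rewrite /prop_for; elim: (index_enum I) => [|i s IH].
  by under eq_fun do rewrite big_nil; exact: cst_continuous.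
by under eq_fun do rewrite big_cons; exact: continuousM.
Qed.

End ContinuousBigop.

Section SmoothAlgebra.
Variables (R : realType) (V : normedModType R) (G : set (V -> R)).

(** Membership in the algebra generated by [G] is what survives repeated differentiation: if the
    derivatives of the generators lie in it, so do those of all its members. *)
Inductive gen_alg : (V -> R) -> Prop :=
| GenCst c : gen_alg (fun=> c)
| GenGen g : G g -> gen_alg g
| GenAdd f g : gen_alg f -> gen_alg g -> gen_alg (fun x => f x + g x)
| GenMul f g : gen_alg f -> gen_alg g -> gen_alg (fun x => f x * g x).

Lemma gen_alg_sum (I : finType) (f : I -> V -> R) :
  (forall i, gen_alg (f i)) -> gen_alg (fun x => \sum_i f i x).
Proof.
move=> H; elim: (index_enum I) => [|i s IH].
  by under eq_fun do rewrite big_nil; exact: GenCst.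
by under eq_fun do rewrite big_cons; exact: GenAdd.
Qed.

Lemma gen_alg_prod (I : finType) (f : I -> V -> R) :
  (forall i, gen_alg (f i)) -> gen_alg (fun x => \prod_i f i x).
Proof.
move=> H; elim: (index_enum I) => [|i s IH].
  by under eq_fun do rewrite big_nil; exact: GenCst.
by under eq_fun do rewrite big_cons; exact: GenMul.
Qed.

Lemma gen_algN f : gen_alg f -> gen_alg (fun x => - f x).
Proof.
by move=> H; under eq_fun do rewrite -mulN1r; apply: GenMul => //; exact: GenCst.
Qed.

Lemma gen_algB f g : gen_alg f -> gen_alg g -> gen_alg (fun x => f x - g x).
Proof. by move=> Hf Hg; apply: GenAdd => //; exact: gen_algN. Qed.

Variable U : set V.
Hypothesis oU : open U.
Hypothesis G_derive : forall g, G g -> forall w, exists2 dg, gen_alg dg &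
  forall x, U x -> is_derive x w g (dg x).
Hypothesis G_cont : forall g, G g -> forall x, U x -> {for x, continuous g}.

Lemma gen_alg_derive f : gen_alg f -> forall w, exists2 df, gen_alg df &
  forall x, U x -> is_derive x w f (df x).
Proof.
elim=> [c|g Gg|g h ag IHg ah IHh|g h ag IHg ah IHh] w.
- by exists (fun=> 0); [exact: GenCst|move=> x _; exact: is_derive_cst].
- exact: G_derive.
- have [dg adg Dg] := IHg w; have [dh adh Dh] := IHh w.
  exists (fun x => dg x + dh x); first exact: GenAdd.
  by move=> x Ux; have ? := Dg x Ux; have ? := Dh x Ux; exact: is_deriveD.
- have [dg adg Dg] := IHg w; have [dh adh Dh] := IHh w.
  exists (fun x => g x * dh x + h x * dg x); first by apply: GenAdd; exact: GenMul.
  by move=> x Ux; have ? := Dg x Ux; have ? := Dh x Ux; exact: is_deriveM.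
Qed.

Lemma gen_alg_cont f : gen_alg f -> forall x, U x -> {for x, continuous f}.
Proof.
elim=> [c|g Gg|g h ag IHg ah IHh|g h ag IHg ah IHh] x Ux.
- exact: cst_continuous.
- exact: G_cont.
- by apply: continuousD; [exact: IHg|exact: IHh].
- by apply: continuousM; [exact: IHg|exact: IHh].
Qed.

Lemma mx_continuous (m n : nat) (f : V -> 'M[R]_(m, n)) x :
  (forall i j, {for x, continuous (fun y => f y i j)}) -> {for x, continuous f}.
Proof.
move=> H; apply/cvg_ballP => e e0.
have : \forall y \near x, forall i j, ball (f x i j) e (f y i j).
  apply: filter_forall => i; apply: filter_forall => j.
  by have /cvg_ballP := H i j; apply.
by apply: filterS => y yb; split.
Qed.

(** Every iterated directional derivative agrees on [U] with a matrix of members of the algebra,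
    hence is again derivable and continuous there. *)
Lemma smooth_on_gen_alg (m n : nat) (f : V -> 'M[R]_(m, n)) :
  (forall i j, gen_alg (fun x => f x i j)) -> smooth_on U f.
Proof.
move=> af.
have nU x : U x -> \near x, U x by move=> Ux; exact: open_nbhs_nbhs.
have H vs : exists2 F : V -> 'M[R]_(m, n),
    forall i j, gen_alg (fun x => F x i j) &
    forall x, U x -> iter_deriv vs f x = F x.
  elim: vs => [|w vs [F aF eF]]; first by exists f.
  have /choice [D HD] : forall ij : 'I_m * 'I_n, exists df, gen_alg df /\
      forall x, U x -> is_derive x w (fun x => F x ij.1 ij.2) (df x).
    by move=> [i j]; have [df ? ?] := gen_alg_derive (aF i j) w; exists df.
  exists (fun x => \matrix_(i, j) D (i, j) x) => [i j|x Ux].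
    by under eq_fun do rewrite mxE; case: (HD (i, j)).
  have DF : is_derive x w F (\matrix_(i, j) D (i, j) x).
    by apply: is_derive_mx => i j; rewrite mxE; exact: (HD (i, j)).2.
  (* The induction hypothesis holds on [U] only; openness of [U] makes it an equality near [x],
     which is what differentiation requires. *)
  rewrite /= -[RHS](@derive_val _ _ _ _ _ _ _ DF); apply: near_eq_derive.
  by apply: filterS (nU x Ux) => y; exact: eF.
move=> vs; have [F aF eF] := H vs.
have ne x : U x -> \near x, F x = iter_deriv vs f x.
  by move=> Ux; apply: filterS (nU x Ux) => y /eF.
split.
- move=> x Ux w; apply: (near_eq_derivable (ne x Ux)).
  by apply/derivable_mxP => i j; have [df _ /(_ x Ux)[]] := gen_alg_derive (aF i j) w.
- rewrite continuous_open_subspace // => x /set_mem Ux.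
  have cF : {for x, continuous F}.
    by apply: mx_continuous => i j; exact: gen_alg_cont.
  rewrite /continuous_at (eF x Ux); apply: cvg_trans cF.
  by apply: near_eq_cvg; exact: ne.
Qed.

End SmoothAlgebra.

(** * Determinants and Lagrangian frames *)

Section TwoExceptionalRows.
Variables (F : comPzRingType) (m : nat) (p q : 'I_m).
Hypothesis pq : p != q.

Lemma perm_fix_offpair (s : {perm 'I_m}) :
  (forall k, k != p -> k != q -> s k = k) -> s = 1%g \/ s = tperm p q.
Proof.
move=> fix_s.
have spq : s p = p \/ s p = q.
  case: (eqVneq (s p) p) => [|np]; first by left.
  case: (eqVneq (s p) q) => [|nq]; first by right.
  by have := fix_s _ np nq => /perm_inj e; rewrite e eqxx in np.
have sqp : s q = q \/ s q = p.
  case: (eqVneq (s q) q) => [|nq]; first by left.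
  case: (eqVneq (s q) p) => [|np]; first by right.
  by have := fix_s _ np nq => /perm_inj e; rewrite e eqxx in nq.
case: spq sqp => [ep|ep] [eq_|eq_].
- left; apply/permP => k; rewrite perm1.
  case: (eqVneq k p) => [->//|np]; case: (eqVneq k q) => [->//|nq]; exact: fix_s.
- by have := pq; rewrite -(inj_eq (@perm_inj _ s)) ep eq_ eqxx.
- by have := pq; rewrite -(inj_eq (@perm_inj _ s)) ep eq_ eqxx.
- right; apply/permP => k; case: tpermP => [->//|->//|/eqP np /eqP nq]; exact: fix_s.
Qed.

(** A row other than [p] and [q] vanishes off the diagonal, so a permutation contributing to the
    Leibniz sum fixes every other index: only the identity and the transposition of [p] and [q]
    remain. *)
Lemma det_two_rows (M : 'M[F]_m) :
  (forall k j, k != p -> k != q -> j != k -> M k j = 0) ->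
  \det M = (M p p * M q q - M p q * M q p) * \prod_(k | (k != p) && (k != q)) M k k.
Proof.
move=> M0; rewrite /determinant.
have n1 : (1 != tperm p q :> {perm 'I_m})%g.
  apply/eqP => /permP /(_ p); rewrite perm1 tpermL => /eqP.
  by rewrite (negbTE pq).
rewrite (bigD1 1%g) //= (bigD1 (tperm p q)) /=; last by rewrite eq_sym.
rewrite [X in _ + (_ + X)]big1 ?addr0; last first.
  move=> s /andP[s1 st]; rewrite mulrC.
  have : exists k, [&& k != p, k != q & s k != k].
    apply: contrapT => H; have [] := @perm_fix_offpair s.
    - move=> k kp kq; apply/eqP; apply: contrapT => /negP sk.
      by apply: H; exists k; rewrite kp kq.
    - by move=> e; rewrite e eqxx in s1.
    - by move=> e; rewrite e eqxx in st.
  case=> k /and3P[kp kq sk].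
  by rewrite (bigD1 k) //= M0 // !mul0r.
rewrite odd_perm1 expr0 mul1r odd_tperm pq expr1 mulN1r mulrBl.
congr (_ - _).
- rewrite (bigD1 p) //= (bigD1 q) 1?eq_sym //= mulrA !perm1; congr (_ * _).
  by apply: eq_bigr => k _; rewrite perm1.
- rewrite (bigD1 p) //= (bigD1 q) 1?eq_sym //= mulrA tpermL tpermR; congr (_ * _).
  by apply: eq_bigr => k /andP[kp kq]; rewrite tpermD // eq_sym.
Qed.

End TwoExceptionalRows.

Section Frames.
Variables (R : realType) (m : nat) (F : 'I_m -> 'M[R]_(2, m)).
Local Notation C := R[i].
Local Notation toC := (real_complex R).

Let Z : 'M[C]_m := \matrix_(k, j) dz j (F k).

(** A real relation between the frame vectors is a complex relation between the rows of [Z], which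
    is invertible. *)
Lemma Omega_neq0_free : Omega F != 0 ->
  forall c : 'I_m -> R, \sum_(k < m) c k *: F k = 0 -> forall k, c k = 0.
Proof.
move=> O0 c sc.
pose r : 'rV[C]_m := \row_k (c k)%:C%C.
have rZ : r *m Z = 0.
  apply/matrixP => i j; rewrite !mxE.
  have e s : \sum_(k < m) c k * F k s j = 0.
    by move: sc => /matrixP /(_ s j); rewrite summxE mxE => {2}<-;
      apply: eq_bigr => k _; rewrite mxE.
  apply/eqP; rewrite eq_complex /=; apply/andP; split; apply/eqP.
  - rewrite -(e 0) (@raddf_sum _ _ (@complex.Re R : Rcomplex R -> R)).
    by apply: eq_bigr => k _; rewrite !mxE /= mul0r subr0.
  - rewrite -(e 1) (@raddf_sum _ _ (@complex.Im R : Rcomplex R -> R)).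
    by apply: eq_bigr => k _; rewrite !mxE /= mul0r addr0.
have uZ : Z \in unitmx by rewrite unitmxE unitfE.
have r0 : r = 0 by rewrite -(mulmxK uZ r) rZ mul0mx.
by move=> k; move: r0 => /matrixP /(_ 0 k); rewrite !mxE => -[].
Qed.

(** The left side has the shape of [calib], which is thus the real part of the conjugate phase times
    [Omega]. *)
Lemma Re_conj_mul (z w : C) :
  complex.Re z * complex.Re w + complex.Im z * complex.Im w = complex.Re (z^*%C * w).
Proof. by case: z => a b; case: w => c d /=; rewrite mulNr opprK. Qed.

(* A Lagrangian frame has real Hermitian Gram matrix Z Z^*, so its volume is |det Z|. *)
Lemma lagrangian_vol_frame :
  (forall k l, \sum_j (F k 1 j * F l 0 j - F k 0 j * F l 1 j) = 0) ->
  (vol_frame F)%:C%C = `|Omega F|.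
Proof.
move=> lag.
have eG : map_mx toC (gram F) = Z *m (map_mx conjc Z)^T.
  apply/matrixP => k l; rewrite !mxE /ip.
  apply/eqP; rewrite eq_complex /=; apply/andP; split; apply/eqP.
  - rewrite (@raddf_sum _ _ (@complex.Re R : Rcomplex R -> R)).
    rewrite big_ord_recl big_ord1 -big_split /=; apply: eq_bigr => j _.
    by rewrite !mxE /= mulrN opprK; congr (_ * _ + _ * _); congr (F _ _ _); apply/val_inj.
  - rewrite (@raddf_sum _ _ (@complex.Im R : Rcomplex R -> R)) -[LHS](lag k l).
    by apply: eq_bigr => j _; rewrite !mxE /= mulrN addrC.
have dG : (\det (gram F))%:C%C = `|Omega F| ^+ 2.
  rewrite -[LHS]/(toC _) -det_map_mx eG det_mulmx det_tr det_map_mx sqr_normc.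
  done.
have dG0 : 0 <= \det (gram F) by rewrite -lecR dG exprn_ge0.
apply/eqP; rewrite -(@eqrXn2 _ 2) ?normr_ge0 //; last by rewrite lecR sqrtr_ge0.
by rewrite -dG -[X in X ^+ 2]/(toC _) -rmorphXn /= /vol_frame sqr_sqrtr.
Qed.

End Frames.

Lemma sum_complex (R : realType) (I : finType) (f g : I -> R) :
  \sum_i (f i +i* g i)%C = ((\sum_i f i) +i* (\sum_i g i))%C.
Proof.
elim: (index_enum I) => [|i s IH]; first by rewrite !big_nil.
by rewrite !big_cons IH.
Qed.

Lemma prod_polar (R : realType) (I : finType) (r al : I -> R) :
  \prod_i (r i * cos (al i) +i* (r i * sin (al i)))%C =
  ((\prod_i r i) * cos (\sum_i al i) +i* ((\prod_i r i) * sin (\sum_i al i)))%C.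
Proof.
elim: (index_enum I) => [|i s IH].
  by rewrite !big_nil cos0 sin0 mulr0 mulr1.
rewrite !big_cons IH cosD sinD; apply/eqP; rewrite eq_complex /=.
by apply/andP; split; apply/eqP; ring.
Qed.

Lemma normc_i (R : realType) : `|'i%C| = 1 :> R[i].
Proof. by rewrite normc_def /= expr0n /= expr1n add0r sqrtr1. Qed.

Lemma is_derive_prod_logder (R : realType) (V : normedModType R) (I : finType)
    (f : I -> V -> R) (x w : V) (df : I -> R) :
  (forall i, is_derive x w (f i) (df i)) -> (forall i, f i x != 0) ->
  is_derive x w (fun y => \prod_i f i y) (\prod_i f i x * \sum_i df i / f i x).
Proof.
move=> D f0; elim: (index_enum I) => [|i s IH].
  under eq_fun do rewrite big_nil.
  by rewrite !big_nil mulr0; exact: is_derive_cst.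
under eq_fun do rewrite big_cons.
have ? := D i.
rewrite !big_cons; apply: is_derive_eq; rewrite /GRing.scale /=.
by field; exact: f0.
Qed.

Lemma is_derive_bigsum (R : realType) (V : normedModType R) (I : finType)
    (f : I -> V -> R) (x w : V) (df : I -> R) :
  (forall i, is_derive x w (f i) (df i)) ->
  is_derive x w (fun y => \sum_i f i y) (\sum_i df i).
Proof.
move=> D; elim: (index_enum I) => [|i s IH].
  by under eq_fun do rewrite big_nil; rewrite big_nil; exact: is_derive_cst.
under eq_fun do rewrite big_cons.
by have ? := D i; rewrite big_cons; exact: is_deriveD.
Qed.

(** * The flow *)

Section Flow.
Variables (R : realType) (m : nat) (a : 'I_m -> int) (eps : R) (u th ps : R -> R).

Local Notation ar j := ((a j)%:~R : R).
Local Notation I t := (- eps < t < eps).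

Implicit Types s t : R.

(** This is Q'/Q at x. *)
Definition logder (x : R) : R := \sum_(j < m) (ar j / (ar j * x + 1)).
Definition sqlogder (x : R) : R := \sum_(j < m) (ar j ^+ 2 / (ar j * x + 1)).
(** The v of the overview; [sinmom] is its A, taken at time 0 and shown in [sinmomE] to be
    conserved. *)
Definition cosmom (t : R) : R := Num.sqrt (Qpoly a (u t)) * cos (th t).
Definition sinmom : R := Num.sqrt (Qpoly a (u 0)) * sin (th 0).

Hypothesis eps0 : 0 < eps.
Hypothesis a_neq0 : exists j, a j != 0.
Hypothesis hder : forall t : R, I t ->
  [/\ derivable u t 1, derivable th t 1 & derivable ps t 1].
Hypothesis hpos : forall t : R, I t -> forall j, 0 < ar j * u t + 1.
Hypothesis hu : forall t : R, I t ->
  derive1 u t = 2 * Num.sqrt (Qpoly a (u t)) * cos (th t).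
Hypothesis hth : forall t : R, I t ->
  derive1 th t = - Num.sqrt (Qpoly a (u t)) * sin (th t)
                  * \sum_(j < m) ((a j)%:~R / ((a j)%:~R * u t + 1)).
Hypothesis hps : forall t : R, I t ->
  derive1 ps t = - Num.sqrt (Qpoly a (u t)) * sin (th t)
                  * \sum_(j < m) ((a j)%:~R ^+ 2 / ((a j)%:~R * u t + 1)).

Lemma I0 : I 0. Proof. by rewrite oppr_lt0 eps0. Qed.

Lemma Qpoly_gt0 t : I t -> 0 < Qpoly a (u t).
Proof. by move=> It; apply: prodr_gt0 => j _; exact: hpos. Qed.

(** This positivity makes [ps] strictly monotone when A <> 0 and keeps the factor [sqlogder] of
    [det_frame_mx] from vanishing. *)
Lemma sqlogder_gt0 t : I t -> 0 < sqlogder (u t).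
Proof.
move=> It; case: a_neq0 => j aj; rewrite /sqlogder (bigD1 j) //=.
apply: ltr_pwDl; last first.
  by apply: sumr_ge0 => i _; rewrite divr_ge0 ?sqr_ge0 // ltW // hpos.
rewrite divr_gt0 ?hpos // lt_def sqr_ge0 andbT sqrf_eq0.
by rewrite intr_eq0.
Qed.

Lemma derive_u t : I t -> is_derive t 1 u (2 * cosmom t).
Proof.
move=> It; have [du _ _] := hder It; apply: DeriveDef => //.
by rewrite -derive1E hu // /cosmom mulrA.
Qed.

Lemma derive_lin j t : I t ->
  is_derive t 1 (fun s => ar j * u s + 1) (ar j * (2 * cosmom t)).
Proof.
move=> It; have ? := derive_u It; apply: is_derive_eq.
by rewrite /GRing.scale /=; ring.
Qed.

Lemma derive_inv_lin j t : I t ->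
  is_derive t 1 (fun s => (ar j * u s + 1)^-1)
    (- 2 * ar j * cosmom t * (ar j * u t + 1)^-1 ^+ 2).
Proof.
move=> It; have n0 : ar j * u t + 1 != 0 by rewrite gt_eqF // hpos.
have := @is_deriveV R (fun s => ar j * u s + 1) t _ 1 n0 (derive_lin j It).
move/is_derive_eq; apply.
by rewrite /GRing.scale /= -exprVn; ring.
Qed.

Lemma derive_sqrt_lin j t : I t ->
  is_derive t 1 (fun s => Num.sqrt (ar j * u s + 1))
    (ar j * cosmom t * (ar j * u t + 1)^-1 * Num.sqrt (ar j * u t + 1)).
Proof.
move=> It; have p0 := hpos It j.
have := @is_derive1_comp _ Num.sqrt (fun s => ar j * u s + 1) t _ _
  (is_derive1_sqrt p0) (derive_lin j It).
move/is_derive_eq; apply; rewrite -[in X in _ = _ * X^-1 * _](sqr_sqrtr (ltW p0)).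
by field; rewrite gt_eqF // sqrtr_gt0.
Qed.

Lemma derive_sqrtQ t : I t ->
  is_derive t 1 (fun s => Num.sqrt (Qpoly a (u s)))
    (Num.sqrt (Qpoly a (u t)) * logder (u t) * cosmom t).
Proof.
move=> It; have p0 := Qpoly_gt0 It.
have D := @is_derive_prod_logder R R 'I_m (fun j s => ar j * u s + 1) t 1
  (fun j => ar j * (2 * cosmom t)) (fun j => derive_lin j It)
  (fun j => lt0r_neq0 (hpos It j)).
have := @is_derive1_comp _ Num.sqrt (fun s => Qpoly a (u s)) t _ _
  (is_derive1_sqrt p0) D.
move/is_derive_eq; apply.
have -> : \sum_i ar i * (2 * cosmom t) / (ar i * u t + 1)
    = 2 * cosmom t * logder (u t).
  by rewrite /logder mulr_sumr; apply: eq_bigr => i _; ring.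
rewrite -/(Qpoly a (u t)) -[in X in _ * (X * _) = _](sqr_sqrtr (ltW p0)).
by field; rewrite gt_eqF // sqrtr_gt0.
Qed.

Lemma derive_th_raw t : I t ->
  is_derive t 1 th (- (Num.sqrt (Qpoly a (u t)) * sin (th t)) * logder (u t)).
Proof.
move=> It; have [_ d _] := hder It; apply: DeriveDef => //.
by rewrite -derive1E hth // mulNr.
Qed.

(** The two terms of the product rule are plus and minus [logder] times v sqrt Q sin th. *)
Lemma sinmomE t : I t -> Num.sqrt (Qpoly a (u t)) * sin (th t) = sinmom.
Proof.
move=> It; pose f s := Num.sqrt (Qpoly a (u s)) * sin (th s).
apply: (@derive0_const R (- eps) eps f) It I0 => x Ix.
have ? := derive_sqrtQ Ix.
have ? := is_derive1_comp (is_derive_sin (th x)) (derive_th_raw Ix).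
rewrite /f; apply: is_derive_eq; rewrite /GRing.scale /= /cosmom; ring.
Qed.

Lemma derive_th t : I t -> is_derive t 1 th (- sinmom * logder (u t)).
Proof. by move=> It; have := derive_th_raw It; rewrite sinmomE. Qed.

Lemma derive_ps t : I t -> is_derive t 1 ps (- sinmom * sqlogder (u t)).
Proof.
move=> It; have [_ _ d] := hder It; apply: DeriveDef => //.
by rewrite -derive1E hps // -(sinmomE It) mulNr.
Qed.

(** The product rule gives [logder] times v^2 + A^2, and this sum of squares is Q. *)
Lemma derive_cosmom t : I t ->
  is_derive t 1 cosmom (Qpoly a (u t) * logder (u t)).
Proof.
move=> It; have ? := derive_sqrtQ It.
have ? := is_derive1_comp (is_derive_cos (th t)) (derive_th It).
rewrite /cosmom; apply: is_derive_eq; rewrite /GRing.scale /= -(sinmomE It) /cosmom.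
rewrite -[Qpoly _ _ in RHS](sqr_sqrtr (ltW (Qpoly_gt0 It))).
by have := cos2Dsin2 (th t) => /(canRL (addrK _)) e; ring: e.
Qed.

Lemma mom_sqr t : I t -> cosmom t ^+ 2 + sinmom ^+ 2 = Qpoly a (u t).
Proof.
move=> It; rewrite -(sinmomE It) /cosmom !exprMn -mulrDr cos2Dsin2 mulr1.
by rewrite sqr_sqrtr // ltW // Qpoly_gt0.
Qed.

(** Dividing v and A by sqrt Q > 0 recovers e^(i th). For this reason [gap] below carries no term in
    [th]. *)
Lemma eqang_mom s t : I s -> I t -> u s = u t -> cosmom s = cosmom t ->
  eqang (th s) (th t).
Proof.
move=> Is It us cs.
have n0 : Num.sqrt (Qpoly a (u t)) != 0 by rewrite gt_eqF // sqrtr_gt0 Qpoly_gt0.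
split; apply: (mulfI n0).
- by rewrite -[RHS]/(cosmom t) -cs /cosmom us.
- by rewrite sinmomE // -us sinmomE.
Qed.

(** When A = 0, [th] is constant and v^2 = Q > 0, so v keeps the sign it has at time 0. That sign is
    [sg], which merges the increasing and decreasing cases. *)
Lemma strict_u : sinmom = 0 -> exists2 sg : R, sg ^+ 2 = 1 &
  forall s t, - eps < s -> s < t -> t < eps -> sg * u s < sg * u t.
Proof.
move=> A0.
have c0 t : I t -> cosmom t != 0.
  move=> It; rewrite -sqrf_eq0; have := mom_sqr It.
  by rewrite A0 expr0n /= addr0 => ->; rewrite gt_eqF // Qpoly_gt0.
have thc t : I t -> th t = th 0.
  move=> It; apply: (derive0_const (a := - eps) (b := eps)) It I0 => x Ix.
  by have := derive_th Ix; rewrite A0 oppr0 mul0r.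
have cc t : I t -> 0 < cosmom t * cosmom 0.
  move=> It; rewrite /cosmom mulrACA (thc t It) mulr_gt0 //.
    by rewrite mulr_gt0 // sqrtr_gt0 Qpoly_gt0 // I0.
  rewrite -expr2 lt_def sqr_ge0 andbT sqrf_eq0.
  by have := c0 0 I0; rewrite /cosmom mulf_eq0 negb_or => /andP[].
exists (Num.sg (cosmom 0)); first by rewrite sqr_sg (c0 _ I0).
move=> s t es st te.
apply: (@derive_gt0_lt R (- eps) eps (fun x => Num.sg (cosmom 0) * u x)
  (fun x => Num.sg (cosmom 0) * (2 * cosmom x)) s t _ _ es st te) => x Ix.
  by have ? := derive_u Ix; apply: is_derive_eq; rewrite /GRing.scale /=; ring.
rewrite mulrCA mulr_gt0 // -(pmulr_rgt0 _ (_ : 0 < `|cosmom 0|)); last first.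
  by rewrite normr_gt0 c0 // I0.
by rewrite mulrA [_ * Num.sg _]mulrC -numEsg mulrC cc.
Qed.

Lemma strict_ps : sinmom != 0 -> exists2 sg : R, sg ^+ 2 = 1 &
  forall s t, - eps < s -> s < t -> t < eps -> sg * ps s < sg * ps t.
Proof.
move=> A0.
exists (- Num.sg sinmom); first by rewrite sqrrN sqr_sg A0.
move=> s t es st te.
apply: (@derive_gt0_lt R (- eps) eps (fun x => - Num.sg sinmom * ps x)
  (fun x => - Num.sg sinmom * (- sinmom * sqlogder (u x))) s t _ _ es st te) => x Ix.
  by have ? := derive_ps Ix; apply: is_derive_eq; rewrite /GRing.scale /=; ring.
by rewrite !mulNr mulrN opprK mulrA -normrEsg mulr_gt0 ?normr_gt0 // sqlogder_gt0.
Qed.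

(** Here [ps] is compared as a real number, not modulo 2 pi, so a periodic orbit is no
    counterexample. It is applied only where the angles already agree as real numbers. *)
Lemma curve_inj s t : I s -> I t -> u s = u t -> ps s = ps t -> s = t.
Proof.
move=> /andP[ls sl] /andP[lt tl] eu ep.
have key : exists g : R -> R, g s = g t /\
    (forall s t, - eps < s -> s < t -> t < eps -> g s < g t).
  case: (eqVneq sinmom 0) => [/strict_u|/strict_ps] [sg _ H].
  - by exists (fun x => sg * u x); rewrite eu.
  - by exists (fun x => sg * ps x); rewrite ep.
case: key => g [eg mono].
case: (ltgtP s t) => // st.
- by have := mono s t ls st tl; rewrite eg ltxx.
- by have := mono t s lt st sl; rewrite eg ltxx.
Qed.

(** Squared distance between the points (u, v, e^(i ps)) at times [s] and [t]: the last term is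
    |e^(i ps(s)) - e^(i ps(t))|^2. *)
Definition gap s t : R :=
  (u s - u t) ^+ 2 + (cosmom s - cosmom t) ^+ 2 + 2 * (1 - cos (ps s - ps t)).

Lemma gap_eq0 s t : gap s t <= 0 ->
  [/\ u s = u t, cosmom s = cosmom t & eqang (ps s) (ps t)].
Proof.
move=> H; have := sqr_ge0 (u s - u t); have := sqr_ge0 (cosmom s - cosmom t).
have c1 := cos_le1 (ps s - ps t); move: H; rewrite /gap => H g1 g2.
split.
- by apply/eqP; rewrite -subr_eq0 -sqrf_eq0; apply/eqP; lra.
- by apply/eqP; rewrite -subr_eq0 -sqrf_eq0; apply/eqP; lra.
- by apply/eqang_cos_sub; lra.
Qed.

(** * Gronwall estimate for the orbit and return times *)

Variables p q : 'I_m.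
Hypothesis ap : a p < 0.
Hypothesis aq : 0 < a q.

(** The integers a_q >= 1 and a_p <= -1 bound u from below and from above respectively. *)
Lemma u_lt1 t : I t -> `|u t| <= 1.
Proof.
move=> It; have := hpos It p; have := hpos It q.
have q1 : 1 <= ar q by rewrite -[1]/(1%:~R) ler_int -gtz0_ge1.
have p1 : ar p <= -1.
  by rewrite -[-1]/((-1)%:~R) ler_int -lerN2 opprK -gtz0_ge1 oppr_gt0.
by move=> H1 H2; rewrite ler_norml; apply/andP; split; nra.
Qed.

Let urange : set R := [set x | exists2 t, I t & x = u t].

Lemma lipb_lin j : lipb urange (fun x => ar j * x + 1).
Proof.
apply: lipbD; last exact: lipb_cst.
apply: lipbM; first exact: lipb_cst.
by apply: (@lipb_id _ _ 1) => x [t It ->]; exact: u_lt1.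
Qed.

Section NonzeroMoment.
Hypothesis A0 : sinmom != 0.

(* Q >= sinmom^2 > 0 along the flow keeps every factor of Q away from 0. *)
Lemma lipb_inv_lin j : lipb urange (fun x => (ar j * x + 1)^-1).
Proof.
have [M M0 HM] : lipb urange (fun x => \prod_(i | i != j) (ar i * x + 1)).
  by apply: lipb_prod; exact: lipb_lin.
have A2 : 0 < sinmom ^+ 2 by rewrite lt_def sqr_ge0 andbT sqrf_eq0.
apply: (@lipbV _ _ _ (sinmom ^+ 2 / (M + 1))); last exact: lipb_lin.
  by rewrite divr_gt0 // ltr_wpDl.
move=> x [t It xt]; have Dx : urange x by exists t.
have [b _] := HM x x Dx Dx.
rewrite ler_pdivrMr; last by rewrite ltr_wpDl.
have := mom_sqr It; rewrite /Qpoly (bigD1 j) //= -xt => e.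
apply: (@le_trans _ _ ((ar j * x + 1) * \prod_(i < m | i != j) (ar i * x + 1))).
  by rewrite -e lerDr sqr_ge0.
rewrite ler_pM2l; last by rewrite xt hpos.
by rewrite (le_trans (ler_norm _)) // (le_trans b) // lerDl.
Qed.

(** The system is autonomous, so h |-> s + h and h |-> t + h follow two solutions of the same
    equations. Gronwall's inequality in the variable h compares them. *)
Lemma gap_gronwall : exists C : R, forall s t h, I s -> I t ->
  I (s + h) -> I (t + h) -> gap (s + h) (t + h) <= expR (C * `|h|) * gap s t.
Proof.
have [L1 L10 HL1] : lipb urange (fun x => Qpoly a x * logder x).
  apply: lipbM; first by apply: lipb_prod; exact: lipb_lin.
  apply: lipb_sum => j; apply: lipbM; [exact: lipb_cst|exact: lipb_inv_lin].
have [L2 L20 HL2] : lipb urange sqlogder.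
  apply: lipb_sum => j; apply: lipbM; [exact: lipb_cst|exact: lipb_inv_lin].
(* With U, V, X, Y the differences of u, v, Q', [sqlogder] and x that of [ps]: 4|UV| <= 2U^2 + 2V^2,
   2|VX| <= V^2 + L1^2 U^2 and 2|sin x A Y| <= sin^2 x + (A L2)^2 U^2. The largest numerical
   coefficient is the 3 of V^2. *)
exists (3 + L1 ^+ 2 + (sinmom * L2) ^+ 2) => s t h Is It Ish Ith.
pose dg h := 2 * (u (s + h) - u (t + h)) * (2 * cosmom (s + h) - 2 * cosmom (t + h))
  + 2 * (cosmom (s + h) - cosmom (t + h))
    * (Qpoly a (u (s + h)) * logder (u (s + h)) - Qpoly a (u (t + h)) * logder (u (t + h)))
  + 2 * sin (ps (s + h) - ps (t + h))
    * (- sinmom * sqlogder (u (s + h)) - - sinmom * sqlogder (u (t + h))).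
(* The interval of those shifts that keep both times inside (-eps, eps). *)
pose lo := - eps - Num.min s t; pose hi := eps - Num.max s t.
have inI k : lo < k < hi -> I (s + k) /\ I (t + k).
  rewrite /lo /hi => /andP[]; rewrite ltrBlDr ltrBrDr => k1 k2.
  have k3 : - eps < k + s /\ - eps < k + t.
    by split; apply: (lt_le_trans k1); rewrite lerD2l ge_min lexx ?orbT.
  have k4 : k + s < eps /\ k + t < eps.
    by split; apply: le_lt_trans k2; rewrite lerD2l le_max lexx ?orbT.
  by rewrite ![_ + k]addrC k3.1 k3.2 k4.1 k4.2.
have Iin k : I (s + k) -> I (t + k) -> lo < k < hi.
  move=> /andP[s1 s2] /andP[t1 t2]; rewrite /lo /hi ltrBlDr ltrBrDr.
  rewrite addrC in s1; rewrite addrC in s2; rewrite addrC in t1; rewrite addrC in t2.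
  by apply/andP; split; [case: (leP s t)|case: (leP s t)].
have sh (f : R -> R) (df c k : R) : is_derive (c + k) 1 f df ->
    is_derive k 1 (fun k => f (c + k)) df.
  move=> Df; have H : is_derive k (1 : R) (fun k : R => c + k) 1.
    by rewrite -[X in is_derive _ _ _ X]add0r; apply: is_deriveD.
  by have := is_derive1_comp Df H; rewrite mulr1.
have := @gronwall R lo hi (fun k => gap (s + k) (t + k)) dg
  (3 + L1 ^+ 2 + (sinmom * L2) ^+ 2) 0 h.
rewrite subr0 !addr0; apply.
- move=> k /inI[Isk Itk].
  have ? := sh u _ s k (derive_u Isk); have ? := sh u _ t k (derive_u Itk).
  have ? := sh _ _ s k (derive_cosmom Isk); have ? := sh _ _ t k (derive_cosmom Itk).
  have ? := sh _ _ s k (derive_ps Isk); have ? := sh _ _ t k (derive_ps Itk).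
  have Dps : is_derive k 1 (fun k => ps (s + k) - ps (t + k))
     (- sinmom * sqlogder (u (s + k)) - - sinmom * sqlogder (u (t + k))).
    exact: is_deriveB.
  have ? := @is_derive1_comp _ cos (fun k => ps (s + k) - ps (t + k)) k _ _
    (is_derive_cos _) Dps.
  rewrite /gap; apply: is_derive_eq; rewrite /GRing.scale /= /dg; ring.
- move=> k /inI[Isk Itk]; rewrite /dg /gap.
  have Ds : urange (u (s + k)) by exists (s + k).
  have Dt : urange (u (t + k)) by exists (t + k).
  have [_ l1] := HL1 _ _ Ds Dt; have [_ l2] := HL2 _ _ Ds Dt.
  move: l1 l2.
  set U := u (s + k) - u (t + k); set V := cosmom (s + k) - cosmom (t + k).
  set X := _ - _ * logder _; set Y := sqlogder _ - sqlogder _.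
  set x := ps _ - ps _ => l1 l2.
  (* sin^2 = (1 - cos)(1 + cos), and 1 + cos <= 2. *)
  have s2 : sin x ^+ 2 <= 2 * (1 - cos x).
    have := cos2Dsin2 x; have := cos_le1 x; have := cos_geN1 x.
    by move=> c1 c2 c3; nra.
  have X2 : X ^+ 2 <= L1 ^+ 2 * U ^+ 2.
    exact: sqr_le_norm.
  have Y2 : (sinmom * Y) ^+ 2 <= (sinmom * L2) ^+ 2 * U ^+ 2.
    rewrite [leLHS]exprMn [(sinmom * L2) ^+ 2]exprMn -[leRHS]mulrA.
    apply: ler_wpM2l; first exact: sqr_ge0.
    exact: sqr_le_norm.
  have -> : 2 * U * (2 * cosmom (s + k) - 2 * cosmom (t + k)) + 2 * V * X
      + 2 * sin x * (- sinmom * sqlogder (u (s + k)) - - sinmom * sqlogder (u (t + k)))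
    = 4 * (U * V) + 2 * (V * X) - 2 * (sin x * (sinmom * Y)).
    by rewrite /V /Y; ring.
  have n1 : 2 * `|U * V| <= U ^+ 2 + V ^+ 2 by exact: mul2_norm_le.
  have n2 : 2 * `|V * X| <= V ^+ 2 + X ^+ 2 by exact: mul2_norm_le.
  have n3 : 2 * `|sin x * (sinmom * Y)| <= sin x ^+ 2 + (sinmom * Y) ^+ 2 by exact: mul2_norm_le.
  have N : `|4 * (U * V) + 2 * (V * X) - 2 * (sin x * (sinmom * Y))|
      <= 4 * `|U * V| + 2 * `|V * X| + 2 * `|sin x * (sinmom * Y)|.
    apply: (le_trans (ler_normB _ _)).
    rewrite [`|2 * (sin _ * _)|]normrM [`|2|]gtr0_norm // lerD2r.
    by apply: (le_trans (ler_normD _ _)); rewrite [`|4 * _|]normrM [`|2 * _|]normrM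
      [`|4|]gtr0_norm // [`|2|]gtr0_norm.
  apply: (le_trans N).
  have w0 : 0 <= 2 * (1 - cos x) by rewrite mulr_ge0 // subr_ge0 cos_le1.
  have U0 := sqr_ge0 U; have V0 := sqr_ge0 V.
  have l10 := sqr_ge0 L1; have l20 := sqr_ge0 (sinmom * L2).
  set w := 2 * (1 - cos x) in s2 w0 *.
  move: X2 l10 Y2 l20; move: (L1 ^+ 2) ((sinmom * L2) ^+ 2) => P P2 X2 l10 Y2 l20.
  have e1 : 0 <= P * (V ^+ 2 + w) by rewrite mulr_ge0 // addr_ge0.
  have e2 : 0 <= P2 * (V ^+ 2 + w) by rewrite mulr_ge0 // addr_ge0.
  apply: (@le_trans _ _ (2 * U ^+ 2 + 3 * V ^+ 2 + w + P * U ^+ 2 + P2 * U ^+ 2)).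
    by lra.
  rewrite -subr_ge0; set d := _ - _.
  have -> : d = U ^+ 2 + 2 * w + P * (V ^+ 2 + w) + P2 * (V ^+ 2 + w) by rewrite /d; ring.
  by rewrite !addr_ge0 // mulr_ge0.
- by apply: Iin; rewrite addr0.
- exact: Iin.
Qed.

Lemma cont_u t : I t -> {for t, continuous u}.
Proof. by move=> /derive_u; exact: is_derive_continuous. Qed.

Lemma cont_th t : I t -> {for t, continuous th}.
Proof. by move=> /derive_th; exact: is_derive_continuous. Qed.

Lemma cont_ps t : I t -> {for t, continuous ps}.
Proof. by move=> /derive_ps; exact: is_derive_continuous. Qed.

Lemma cont_cosmom t : I t -> {for t, continuous cosmom}.
Proof. by move=> /derive_cosmom; exact: is_derive_continuous. Qed.

Lemma cont_gap t s : I t -> {for t, continuous (fun x => gap x s)}.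
Proof.
move=> It; apply: continuousD; first apply: continuousD.
- have c : {for t, continuous (fun x => u x - u s)}.
    by apply: continuousB; [exact: cont_u|exact: cst_continuous].
  exact: continuousM.
- have c : {for t, continuous (fun x => cosmom x - cosmom s)}.
    by apply: continuousB; [exact: cont_cosmom|exact: cst_continuous].
  exact: continuousM.
- apply: continuousM; first exact: cst_continuous.
  apply: continuousB; first exact: cst_continuous.
  apply: (@continuous_comp _ _ _ (fun x => ps x - ps s) cos); last exact: continuous_cos.
  by apply: continuousB; [exact: cont_ps|exact: cst_continuous].
Qed.

Lemma nbhs_I t : I t -> \forall x \near t, I x.
Proof.
move=> It; have : nbhs t `](- eps), eps[%classic.
  by apply: open_nbhs_nbhs; split; [exact: itv_open|rewrite /= in_itv].
by apply: filterS => x; rewrite /= in_itv.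
Qed.

(* Near a time t of the closed interval, either the orbit points at t + h and
   t0 + h coincide, and then those at x and t0 + (x - t) do by uniqueness, or the
   gap to t0 is bounded below by Gronwall's inequality. The shift h makes t + h an
   interior time even when t is an endpoint. *)
Lemma return_nonzero t0 (d : R) : I t0 -> 0 < d -> exists2 eta : R, 0 < eta &
  forall t, I t -> gap t t0 < eta -> exists t', [/\ I t', `|t' - t0| < d & gap t t' <= 0].
Proof.
move=> It0 d0.
have [C HC] := gap_gronwall.
have [e e0 He] : exists2 e : R, 0 < e & forall x, `|x - t0| < e -> I x.
  have /nbhs_ballP[e /= e0 be] := nbhs_I It0.
  by exists e => // x xe; apply: be; rewrite /ball /= distrC.
(* Smaller than [e], so that t0 + h0 and t0 - h0 stay in the interval; smaller than [eps], so that a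
   step towards 0 from any t in [-eps, eps] ends at an interior time. *)
pose h0 := Num.min (e / 2) (eps / 2).
have h00 : 0 < h0 by rewrite lt_min !divr_gt0.
have h0e : h0 < e by rewrite gt_min; apply/orP; left; lra.
have h0eps : h0 < eps by rewrite gt_min; apply/orP; right; have := eps0; lra.
pose P (eta t : R) := I t -> gap t t0 < eta ->
  exists t', [/\ I t', `|t' - t0| < d & gap t t' <= 0].
have /compact_near_coveringP cov : compact `[(- eps), eps]%classic.
  exact: segment_compact.
(* Compactness in near-covering form: thresholds valid near each time combine into one valid for all
   times. *)
have {cov} := cov R (0 : R)^'+ P _.
have cover (t : R) : (`[(- eps), eps]%classic : set R) t ->
    \forall x \near t & i \near (0 : R)^'+, P i x.
  rewrite /= in_itv /= => /andP[t1 t2].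
  have [h hh [Ith It0h]] : exists2 h : R, `|h| = h0 & I (t + h) /\ I (t0 + h).
    case: (leP 0 t) => t0'; [exists (- h0)|exists h0]; rewrite ?normrN ?(gtr0_norm h00) //.
    - split; last by apply: He; rewrite addrC addKr normrN gtr0_norm.
      by apply/andP; split; lra.
    - split; last by apply: He; rewrite addrC addKr gtr0_norm.
      by apply/andP; split; lra.
  case: (leP (gap (t + h) (t0 + h)) 0) => g0.
  - pose e1 := Num.min e d.
    have e10 : 0 < e1 by rewrite lt_min e0.
    exists (ball t e1, setT) => /=; first by split; [exact: nbhsx_ballx|exact: filterT].
    move=> [x i] [/= bx _] Ix _; exists (t0 + (x - t)).
    have xt : `|x - t| < e1 by rewrite distrC.
    move: xt; rewrite lt_min => /andP[xe xd].
    have It' : I (t0 + (x - t)) by apply: He; rewrite addrC addKr.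
    split => //; first by rewrite addrC addKr.
    have := HC (t + h) (t0 + h) (x - t - h) Ith It0h.
    have -> : t + h + (x - t - h) = x by ring.
    have -> : t0 + h + (x - t - h) = t0 + (x - t) by ring.
    move=> /(_ Ix It') /le_trans; apply.
    by rewrite pmulr_rle0 ?expR_gt0.
  - have cg : {for t, continuous (fun x => gap (x + h) (t0 + h))}.
      apply: (@continuous_comp _ _ _ (fun x => x + h) (fun x => gap x (t0 + h))).
        by apply: continuousD; [exact: cvg_id|exact: cst_continuous].
      exact: cont_gap.
    have n1 : \forall x \near t, gap (t + h) (t0 + h) / 2 < gap (x + h) (t0 + h).
      by apply: (cvgr_gt _ cg); lra.
    have n2 : \forall x \near t, I (x + h).
      have c2 : {for t, continuous (fun x : R => x + h)}.
        by apply: continuousD; [exact: cvg_id|exact: cst_continuous].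
      exact: (c2 _ (nbhs_I Ith)).
    (* Shifting by [h] enlarges the gap at most by the factor exp(C h0), so a gap below [e1] at x
       would fall below half of the positive limit gap after the shift. *)
    pose e1 := expR (- (C * h0)) * (gap (t + h) (t0 + h) / 2).
    have e10 : 0 < e1 by rewrite mulr_gt0 ?expR_gt0 // divr_gt0.
    exists ([set x | gap (t + h) (t0 + h) / 2 < gap (x + h) (t0 + h) /\ I (x + h)],
            [set i : R | i < e1]) => /=.
      by split; [exact: filterI|exact: nbhs_right_lt].
    move=> [x i] [/= [gx Ixh] ie] Ix gi; exfalso.
    have := HC x t0 h Ix It0 Ixh It0h; rewrite hh => H.
    have : expR (C * h0) * gap x t0 < gap (t + h) (t0 + h) / 2.
      rewrite -ltr_pdivlMl ?expR_gt0 // -expRN.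
      exact: lt_trans gi ie.
    by move=> /(le_lt_trans H) /(lt_trans gx); rewrite ltxx.
move=> /(_ _ cover) H.
have : \forall i \near (0 : R)^'+, 0 < i /\ `[(- eps), eps]%classic `<=` P i.
  by apply: filterI => //; exact: nbhs_right_gt.
move=> /filter_ex[eta [eta0 Heta]]; exists eta => // t It gt.
by apply: Heta => //=; rewrite in_itv /=; case/andP: It => *; rewrite !ltW.
Qed.

End NonzeroMoment.

(** This is what makes N embedded rather than merely immersed. When A = 0 the time t itself is close
    to t0, by strict monotonicity of u. *)
Lemma curve_return t0 (d : R) : I t0 -> 0 < d -> exists2 eta : R, 0 < eta &
  forall t, I t -> gap t t0 < eta -> exists t', [/\ I t', `|t' - t0| < d & gap t t' <= 0].
Proof.
move=> It0 d0; case: (eqVneq sinmom 0) => A0; last exact: return_nonzero.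
have [sg sg1 mono] := strict_u A0.
have [e e0 He] : exists2 e : R, 0 < e & forall x, `|x - t0| < e -> I x.
  have /nbhs_ballP[e /= e0 be] := nbhs_I It0.
  by exists e => // x xe; apply: be; rewrite /ball /= distrC.
pose k := Num.min (e / 2) (d / 2).
have k0 : 0 < k by rewrite lt_min !divr_gt0.
have kd : k < d by rewrite gt_min; apply/orP; right; lra.
have ke : k < e by rewrite gt_min; apply/orP; left; lra.
have I1 : I (t0 + k) by apply: He; rewrite addrC addKr gtr0_norm.
have I2 : I (t0 - k) by apply: He; rewrite addrC addKr normrN gtr0_norm.
(* The changes of u over the steps from t0 to t0 + k and from t0 - k to t0. A value of u closer than
   both to u(t0) forces |t - t0| <= k. *)
pose d1 := sg * u (t0 + k) - sg * u t0; pose d2 := sg * u t0 - sg * u (t0 - k).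
have d10 : 0 < d1.
  by rewrite subr_gt0; case/andP: It0 => ? ?; case/andP: I1 => ? ?; apply: mono => //; lra.
have d20 : 0 < d2.
  by rewrite subr_gt0; case/andP: It0 => ? ?; case/andP: I2 => ? ?; apply: mono => //; lra.
exists (Num.min d1 d2 ^+ 2); first by rewrite exprn_gt0 // lt_min d10.
move=> t It gt.
have dt : (sg * u t - sg * u t0) ^+ 2 < Num.min d1 d2 ^+ 2.
  apply: le_lt_trans gt; rewrite -mulrBr exprMn sg1 mul1r /gap -addrA lerDl.
  by rewrite addr_ge0 ?sqr_ge0 // mulr_ge0 // subr_ge0 cos_le1.
have {}dt : `|sg * u t - sg * u t0| < Num.min d1 d2.
  rewrite -(@ltr_pXn2r _ 2) // ?nnegrE ?real_normK ?num_real //.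
  by rewrite le_min !ltW.
move: dt; rewrite lt_min => /andP[l1 l2].
exists t; split => //; last first.
  by rewrite /gap !subrr cos0 subrr expr0n /= !addr0 mulr0.
apply: le_lt_trans kd; rewrite ler_norml lerBrDr lerBlDr [- k + _]addrC [k + _]addrC.
case/andP: It => tl tr; case/andP: I1 => I1l I1r; case/andP: I2 => I2l I2r.
apply/andP; split; rewrite leNgt; apply/negP => H.
- have := mono _ _ tl H I2r; have := ler_norm (- (sg * u t - sg * u t0)).
  by rewrite normrN => n1 n2; move: l2; rewrite /d2; lra.
- have := mono _ _ I1l H tr; have := ler_norm (sg * u t - sg * u t0).
  by move=> n1 n2; move: l1; rewrite /d1; lra.
Qed.

(** * The parametrization *)

Hypothesis asum : \sum_(j < m) a j = 0.

Lemma pq : p != q.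
Proof. by apply/eqP => e; move: ap; rewrite e => /(lt_trans aq); rewrite ltxx. Qed.

Lemma ar_pq : 0 < ar q - ar p.
Proof. by rewrite subr_gt0 ltr_int (lt_trans ap aq). Qed.

Lemma ar_sum : \sum_(j < m) ar j = 0.
Proof. by rewrite -rmorph_sum /= asum. Qed.

(** [coef_th] and [coef_ps] are the vectors supported on {p, q} that are dual to the two functionals
    sum of alpha_j and sum of a_j alpha_j. *)
Definition coef_th (j : 'I_m) : R :=
  ((j == p)%:R * ar q - (j == q)%:R * ar p) / (ar q - ar p).
Definition coef_ps (j : 'I_m) : R := ((j == q)%:R - (j == p)%:R) / (ar q - ar p).

Lemma sum_delta (f : 'I_m -> R) k : \sum_(j < m) (j == k)%:R * f j = f k.
Proof.
rewrite (bigD1 k) //= eqxx mul1r big1 ?addr0 // => j /negbTE ->.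
by rewrite mul0r.
Qed.

Lemma sum_coef_th : \sum_(j < m) coef_th j = 1.
Proof.
rewrite /coef_th -mulr_suml sumrB !sum_delta divff // gt_eqF //; exact: ar_pq.
Qed.

Lemma sum_ar_coef_th : \sum_(j < m) ar j * coef_th j = 0.
Proof.
have e j : ar j * coef_th j =
    ((j == p)%:R * (ar j * ar q) - (j == q)%:R * (ar j * ar p)) / (ar q - ar p).
  by rewrite /coef_th; ring.
under eq_bigr do rewrite e.
rewrite -mulr_suml sumrB.
by rewrite !(sum_delta (fun j => ar j * _)) [ar p * _]mulrC subrr mul0r.
Qed.

Lemma sum_coef_ps : \sum_(j < m) coef_ps j = 0.
Proof.
have e j : coef_ps j = ((j == q)%:R * 1 - (j == p)%:R * 1) / (ar q - ar p).
  by rewrite /coef_ps; ring.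
under eq_bigr do rewrite e.
by rewrite -mulr_suml sumrB !(sum_delta (fun=> 1)) subrr mul0r.
Qed.

Lemma sum_ar_coef_ps : \sum_(j < m) ar j * coef_ps j = 1.
Proof.
have e j : ar j * coef_ps j = ((j == q)%:R * ar j - (j == p)%:R * ar j) / (ar q - ar p).
  by rewrite /coef_ps; ring.
under eq_bigr do rewrite e.
by rewrite -mulr_suml sumrB !sum_delta divff // gt_eqF //; exact: ar_pq.
Qed.

Lemma coef_off j : j != p -> j != q -> coef_th j = 0 /\ coef_ps j = 0.
Proof.
by move=> /negbTE jp /negbTE jq; rewrite /coef_th /coef_ps jp jq !mul0r subrr mul0r.
Qed.

Implicit Types x w : 'rV[R]_m.

(* Coordinates of the chart: entry p is log r, entry q is the flow time, the
   other entries are the angles; the angles p and q are then determined by the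
   two linear constraints. *)
Definition angle (x : 'rV[R]_m) (j : 'I_m) : R :=
  x 0 j + coef_th j * (th (x 0 q) - \sum_(k < m) x 0 k)
        + coef_ps j * (ps (x 0 q) - \sum_(k < m) ar k * x 0 k).

Definition param (x : 'rV[R]_m) : 'M[R]_(2, m) :=
  Npoint a (expR (x 0 p)) (u (x 0 q)) (angle x).

Definition dom : set 'rV[R]_m := [set x | I (x 0 q)].

(** The targets [b] and [c] are arbitrary so that the same computation serves [angle] and its
    derivative [angular]. *)
Lemma sum_affine (w : 'rV[R]_m) (b c : R) :
  \sum_(j < m) (w 0 j + coef_th j * (b - \sum_(k < m) w 0 k)
     + coef_ps j * (c - \sum_(k < m) ar k * w 0 k)) = b.
Proof.
rewrite !big_split /= -[X in _ + X + _]mulr_suml -[X in _ + X]mulr_suml.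
by rewrite sum_coef_th sum_coef_ps; ring.
Qed.

Lemma sum_ar_affine (w : 'rV[R]_m) (b c : R) :
  \sum_(j < m) ar j * (w 0 j + coef_th j * (b - \sum_(k < m) w 0 k)
     + coef_ps j * (c - \sum_(k < m) ar k * w 0 k)) = c.
Proof.
under eq_bigr do
  rewrite mulrDr mulrDr [_ * (coef_th _ * _)]mulrA [_ * (coef_ps _ * _)]mulrA.
rewrite !big_split /= -[X in _ + X + _]mulr_suml -[X in _ + X]mulr_suml.
by rewrite sum_ar_coef_th sum_ar_coef_ps; ring.
Qed.

Lemma sum_angle x : \sum_(j < m) angle x j = th (x 0 q).
Proof. exact: sum_affine. Qed.

Lemma sum_ar_angle x : \sum_(j < m) ar j * angle x j = ps (x 0 q).
Proof. exact: sum_ar_affine. Qed.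

Lemma angle_off x j : j != p -> j != q -> angle x j = x 0 j.
Proof.
by move=> jp jq; rewrite /angle; have [-> ->] := coef_off jp jq; rewrite !mul0r !addr0.
Qed.

(** Two solutions differ at [p] and [q] only, by a kernel vector of the matrix with rows (1, 1) and
    (a_p, a_q), whose determinant is a_q - a_p > 0. *)
Lemma angle_unique x (al : 'I_m -> R) :
  (forall j, j != p -> j != q -> x 0 j = al j) ->
  \sum_(j < m) al j = th (x 0 q) -> \sum_(j < m) ar j * al j = ps (x 0 q) ->
  angle x =1 al.
Proof.
move=> off s1 s2.
pose e j := angle x j - al j.
have e0 j : j != p -> j != q -> e j = 0.
  by move=> jp jq; rewrite /e angle_off // off // subrr.
have qp : q != p by rewrite eq_sym pq.
have t1 : e p + e q = 0.
  have : \sum_j e j = 0 by rewrite sumrB sum_angle s1 subrr.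
  rewrite (bigD1 p) //= (bigD1 q) //= big1 ?addr0 // => j /andP[jp jq]; exact: e0.
have t2 : ar p * e p + ar q * e q = 0.
  have : \sum_j ar j * e j = 0.
    under eq_bigr do rewrite mulrBr.
    by rewrite sumrB sum_ar_angle s2 subrr.
  rewrite (bigD1 p) //= (bigD1 q) //= big1 ?addr0 // => j /andP[jp jq].
  by rewrite e0 // mulr0.
have eq0 : e q = 0.
  apply: (mulfI (lt0r_neq0 ar_pq)); rewrite mulr0 -t2 mulrBl.
  by move: t1 => /eqP; rewrite addr_eq0 => /eqP ->; ring.
have ep0 : e p = 0 by move: t1; rewrite eq0 addr0.
move=> j; apply/eqP; rewrite -subr_eq0 -/(e j); apply/eqP.
by case: (eqVneq j p) => [->//|jp]; case: (eqVneq j q) => [->//|jq]; exact: e0.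
Qed.

Lemma image_param : [set P : 'M[R]_(2, m) | exists (r t : R) (al : 'I_m -> R),
        [/\ 0 < r, -eps < t < eps,
            \sum_(j < m) al j = th t,
            \sum_(j < m) (a j)%:~R * al j = ps t &
            P = Npoint a r (u t) al]] = param @` dom.
Proof.
apply/seteqP; split => [P [r [t [al [r0 It s1 s2 ->]]]]|P [x Ix <-]].
- pose x : 'rV[R]_m := \row_k (if k == p then ln r else if k == q then t else al k).
  have xp : x 0 p = ln r by rewrite mxE eqxx.
  have xq : x 0 q = t by rewrite mxE eq_sym (negbTE pq) eqxx.
  exists x; first by rewrite /dom /= xq.
  rewrite /param xp xq lnK ?posrE //; congr Npoint; apply/funext.
  apply: angle_unique; rewrite ?xq // => j /negbTE jp /negbTE jq.
  by rewrite mxE jp jq.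
- exists (expR (x 0 p)), (x 0 q), (angle x); split => //; first exact: expR_gt0.
  + exact: sum_angle.
  + exact: sum_ar_angle.
Qed.

(** [radial] and [angular] are the real and imaginary parts of d log z_j in direction [w], and
    [dparam] is their complex product with z_j. *)
Definition radial (x w : 'rV[R]_m) (j : 'I_m) : R :=
  w 0 p + w 0 q * (ar j * cosmom (x 0 q) * (ar j * u (x 0 q) + 1)^-1).

Definition angular (x w : 'rV[R]_m) (j : 'I_m) : R :=
  w 0 j + coef_th j * (w 0 q * (- sinmom * logder (u (x 0 q))) - \sum_(k < m) w 0 k)
   + coef_ps j * (w 0 q * (- sinmom * sqlogder (u (x 0 q))) - \sum_(k < m) ar k * w 0 k).

Definition dparam (x w : 'rV[R]_m) : 'M[R]_(2, m) :=
  \matrix_(s, j) (if s == 0 then radial x w j * param x 0 j - angular x w j * param x 1 j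
                  else radial x w j * param x 1 j + angular x w j * param x 0 j).

Lemma derive_time (g : R -> R) dg (x w : 'rV[R]_m) : is_derive (x 0 q) 1 g dg ->
  is_derive x w (fun y : 'rV[R]_m => g (y 0 q)) (dg * w 0 q).
Proof.
move=> Dg; have := @is_derive_compR R 'rV[R]_m g (fun y => y 0 q) x w dg (w 0 q) Dg.
by apply; exact: is_derive_coord.
Qed.

Lemma derive_angle x w j : dom x ->
  is_derive x w (fun y => angle y j) (angular x w j).
Proof.
move=> Ix; rewrite /angle /angular.
have ? := derive_time w (derive_th Ix); have ? := derive_time w (derive_ps Ix).
have ? := is_derive_coord x w 0 j.
have ? : is_derive x w (fun y : 'rV[R]_m => \sum_(k < m) y 0 k) (\sum_(k < m) w 0 k).
  by apply: is_derive_bigsum => k; exact: is_derive_coord.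
have ? : is_derive x w (fun y : 'rV[R]_m => \sum_(k < m) ar k * y 0 k)
    (\sum_(k < m) ar k * w 0 k).
  apply: is_derive_bigsum => k; have ? := is_derive_coord x w 0 k.
  by apply: is_derive_eq; rewrite /GRing.scale /=; ring.
by apply: is_derive_eq; rewrite /GRing.scale /=; ring.
Qed.

Lemma derive_param x w : dom x -> is_derive x w param (dparam x w).
Proof.
move=> Ix; apply: is_derive_mx => s j.
have De : is_derive x w (fun y : 'rV[R]_m => expR (y 0 p)) (expR (x 0 p) * w 0 p).
  apply: (@is_derive_compR R 'rV[R]_m expR (fun y => y 0 p)); exact: is_derive_coord.
have Dw := derive_time w (derive_sqrt_lin j Ix).
have Da := derive_angle w j Ix.
have Dc := @is_derive_compR R _ cos (fun y => angle y j) x w _ _ (is_derive_cos _) Da.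
have Ds := @is_derive_compR R _ sin (fun y => angle y j) x w _ _ (is_derive_sin _) Da.
rewrite /param; under eq_fun do rewrite mxE.
rewrite !mxE /=; case: (s == 0) => /=.
- by apply: is_derive_eq; rewrite /GRing.scale /= /radial; ring.
- by apply: is_derive_eq; rewrite /GRing.scale /= /radial; ring.
Qed.

Lemma dom_open : open dom.
Proof.
rewrite openE => x Ix; have /= := nbhs_I Ix.
exact: (@coord_continuous R 1 m 0 q x).
Qed.

Lemma cont_time (f : R -> R) x : {for x 0 q, continuous f} ->
  {for x, continuous (fun y : 'rV[R]_m => f (y 0 q))}.
Proof.
move=> cf; apply: (@continuous_comp _ _ _ (fun y : 'rV[R]_m => y 0 q) f) => //.
exact: coord_continuous.
Qed.

Lemma cont_angle x : dom x -> forall j, {for x, continuous (fun y => angle y j)}.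
Proof.
move=> Ix j; apply: continuousD; first apply: continuousD; first exact: coord_continuous.
- apply: continuousM; first exact: cst_continuous.
  apply: continuousB; first exact: cont_time (cont_th Ix).
  apply: continuous_bigsum => k; exact: coord_continuous.
- apply: continuousM; first exact: cst_continuous.
  apply: continuousB; first exact: cont_time (cont_ps Ix).
  apply: continuous_bigsum => k; apply: continuousM; first exact: cst_continuous.
  exact: coord_continuous.
Qed.

(** The generators include the entries of [param] but not the angles, exponentials or square roots
    from which they are built: differentiating an entry gives entries again, with coefficients
    polynomial in u, v and the 1/(a_j u + 1). *)
Lemma param_smooth : smooth_on dom param.
Proof.
pose G : set ('rV[R]_m -> R) := [set g |
  [\/ g = (fun x => u (x 0 q)), g = (fun x => cosmom (x 0 q)),
      exists j, g = (fun x => (ar j * u (x 0 q) + 1)^-1) |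
      exists (s : 'I_2) j, g = (fun x => param x s j)]].
have Gu : gen_alg G (fun x => u (x 0 q)) by apply: GenGen; constructor 1.
have Gv : gen_alg G (fun x => cosmom (x 0 q)) by apply: GenGen; constructor 2.
have Gi j : gen_alg G (fun x => (ar j * u (x 0 q) + 1)^-1).
  by apply: GenGen; constructor 3; exists j.
have Gp (s : 'I_2) j : gen_alg G (fun x => param x s j).
  by apply: GenGen; constructor 4; exists s, j.
have Gl : gen_alg G (fun x => logder (u (x 0 q))).
  by apply: gen_alg_sum => j; apply: GenMul => //; exact: GenCst.
have Gs : gen_alg G (fun x => sqlogder (u (x 0 q))).
  by apply: gen_alg_sum => j; apply: GenMul => //; exact: GenCst.
have GQ : gen_alg G (fun x => Qpoly a (u (x 0 q))).
  apply: gen_alg_prod => j; apply: GenAdd; last exact: GenCst.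
  by apply: GenMul => //; exact: GenCst.
have Gr w j : gen_alg G (fun x => radial x w j).
  apply: GenAdd; first exact: GenCst.
  apply: GenMul; first exact: GenCst.
  by apply: GenMul => //; apply: GenMul => //; exact: GenCst.
have Ga w j : gen_alg G (fun x => angular x w j).
  apply: GenAdd; first apply: GenAdd; first exact: GenCst.
  - apply: GenMul; first exact: GenCst.
    apply: gen_algB; last exact: GenCst.
    by apply: GenMul; [exact: GenCst|apply: GenMul => //; exact: GenCst].
  - apply: GenMul; first exact: GenCst.
    apply: gen_algB; last exact: GenCst.
    by apply: GenMul; [exact: GenCst|apply: GenMul => //; exact: GenCst].
have Gd g : G g -> forall w, exists2 dg, gen_alg G dg &
    forall x, dom x -> is_derive x w g (dg x).
  case=> [->|->|[j ->]|[s [j ->]]] w.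
  - exists (fun x => 2 * cosmom (x 0 q) * w 0 q).
      by apply: GenMul; [apply: GenMul => //|]; exact: GenCst.
    by move=> x Ix; exact: derive_time (derive_u Ix).
  - exists (fun x => Qpoly a (u (x 0 q)) * logder (u (x 0 q)) * w 0 q).
      by apply: GenMul; [exact: GenMul|exact: GenCst].
    by move=> x Ix; exact: derive_time (derive_cosmom Ix).
  - exists (fun x => (- 2 * ar j * cosmom (x 0 q) * (ar j * u (x 0 q) + 1)^-1 ^+ 2) * w 0 q).
      apply: GenMul; last exact: GenCst.
      apply: GenMul; first by apply: GenMul => //; exact: GenCst.
      by under eq_fun do rewrite expr2; exact: GenMul.
    by move=> x Ix; exact: derive_time (derive_inv_lin j Ix).
  - exists (fun x => dparam x w s j).
      under eq_fun do rewrite mxE; case: (s == 0).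
      + by apply: gen_algB; exact: GenMul.
      + by apply: GenAdd; exact: GenMul.
    move=> x Ix; have [d v] := derive_param w Ix.
    split; first by move/derivable_mxP: d; apply.
    by rewrite -v derive_mx // mxE.
apply: (smooth_on_gen_alg dom_open Gd) => //.
move=> g Gg x Ix.
have cexp : {for x, continuous (fun y : 'rV[R]_m => expR (y 0 p))}.
  apply: (@continuous_comp _ _ _ (fun y : 'rV[R]_m => y 0 p) expR).
    exact: coord_continuous.
  exact: continuous_expR.
have cang := cont_angle Ix.
case: Gg => [->|->|[j ->]|[s [j ->]]].
- exact: cont_time (cont_u Ix).
- exact: cont_time (cont_cosmom Ix).
- exact: cont_time (is_derive_continuous (derive_inv_lin j Ix)).
- have -> : (fun y => param y s j) = (fun y => expR (y 0 p)
      * Num.sqrt (ar j * u (y 0 q) + 1)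
      * (if s == 0 then cos (angle y j) else sin (angle y j))).
    by apply/funext => y; rewrite mxE.
  apply: continuousM; first apply: continuousM => //.
    exact: cont_time (is_derive_continuous (derive_sqrt_lin j Ix)).
  case: (s == 0).
  + by apply: (@continuous_comp _ _ _ (fun y => angle y j) cos) => //; exact: continuous_cos.
  + by apply: (@continuous_comp _ _ _ (fun y => angle y j) sin) => //; exact: continuous_sin.
Qed.

(** * Calibration *)

Lemma unit_rowE k j : ('e_k : 'rV[R]_m) 0 j = (j == k)%:R.
Proof. by rewrite mxE eqxx. Qed.

Lemma partial_param x k : dom x -> partial param x k = dparam x 'e_k.
Proof. by move=> Ix; rewrite /partial; have [_ ->] := derive_param 'e_k Ix. Qed.

Lemma sum_radial x w :
  \sum_(j < m) radial x w j = m%:R * w 0 p + w 0 q * (cosmom (x 0 q) * logder (u (x 0 q))).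
Proof.
rewrite big_split /= sumr_const card_ord mulr_natl; congr (_ + _).
by rewrite /logder !mulr_sumr; apply: eq_bigr => j _; ring.
Qed.

Lemma sum_ar_radial x w :
  \sum_(j < m) ar j * radial x w j = w 0 q * (cosmom (x 0 q) * sqlogder (u (x 0 q))).
Proof.
under eq_bigr do rewrite mulrDr.
rewrite big_split /= -mulr_suml ar_sum mul0r add0r /sqlogder !mulr_sumr.
by apply: eq_bigr => j _; ring.
Qed.

Lemma sum_angular x w :
  \sum_(j < m) angular x w j = w 0 q * (- sinmom * logder (u (x 0 q))).
Proof. exact: sum_affine. Qed.

Lemma sum_ar_angular x w :
  \sum_(j < m) ar j * angular x w j = w 0 q * (- sinmom * sqlogder (u (x 0 q))).
Proof. exact: sum_ar_affine. Qed.

Lemma param0 x j : param x 0 j =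
  expR (x 0 p) * Num.sqrt (ar j * u (x 0 q) + 1) * cos (angle x j).
Proof. by rewrite mxE. Qed.

Lemma param1 x j : param x 1 j =
  expR (x 0 p) * Num.sqrt (ar j * u (x 0 q) + 1) * sin (angle x j).
Proof. by rewrite mxE. Qed.

Lemma param_norm x j : dom x ->
  param x 0 j ^+ 2 + param x 1 j ^+ 2 = expR (x 0 p) ^+ 2 * (ar j * u (x 0 q) + 1).
Proof.
move=> Ix; rewrite param0 param1 ![(_ * cos _) ^+ 2]exprMn ![(_ * sin _) ^+ 2]exprMn.
rewrite -mulrDr cos2Dsin2 mulr1 exprMn sqr_sqrtr // ltW //; exact: hpos.
Qed.

(** Term by term the sum is a_j, and the a_j add up to 0. *)
Lemma logder_relation t : I t -> u t * sqlogder (u t) + logder (u t) = 0.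
Proof.
move=> It; rewrite /sqlogder /logder mulr_sumr -big_split /= -[RHS]ar_sum.
apply: eq_bigr => j _; field; rewrite gt_eqF //; exact: hpos.
Qed.

(** The terms in w'_p cancel by [logder_relation]. What remains is symmetric in [w] and [w'], so the
    Kähler form, which is the antisymmetrized pairing, vanishes. *)
Lemma lagrangian_pairing x w w' : dom x ->
  \sum_(j < m) (ar j * u (x 0 q) + 1) * (radial x w' j * angular x w j)
   = w 0 q * w' 0 q * cosmom (x 0 q) * (- sinmom * sqlogder (u (x 0 q))).
Proof.
move=> Ix; set t := x 0 q.
have e j : (ar j * u t + 1) * (radial x w' j * angular x w j)
    = w' 0 p * u t * (ar j * angular x w j) + w' 0 p * angular x w j
      + w' 0 q * cosmom t * (ar j * angular x w j).
  rewrite /radial -/t; field; rewrite gt_eqF //; exact: hpos.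
under eq_bigr do rewrite e.
rewrite !big_split /= -!mulr_sumr sum_angular sum_ar_angular -/t.
have -> : logder (u t) = - (u t * sqlogder (u t)).
  by apply/eqP; rewrite -addr_eq0 addrC logder_relation.
by ring.
Qed.

Lemma param_lagrangian x w w' : dom x ->
  \sum_j (dparam x w 1 j * dparam x w' 0 j - dparam x w 0 j * dparam x w' 1 j) = 0.
Proof.
move=> Ix; rewrite (eq_bigr (fun j => expR (x 0 p) ^+ 2 *
    ((ar j * u (x 0 q) + 1) * (radial x w' j * angular x w j)
     - (ar j * u (x 0 q) + 1) * (radial x w j * angular x w' j)))); last first.
  move=> j _; rewrite -mulrBr mulrA -param_norm // !mxE /=; ring.
rewrite -mulr_sumr sumrB !lagrangian_pairing // [w' 0 q * _]mulrC.
by rewrite subrr mulr0.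
Qed.

(** The values of d log z_j on the coordinate vectors, so [Omega] of the frame is this determinant
    times the product of the z_j. *)
Definition frame_mx x : 'M[R[i]]_m :=
  \matrix_(k, j) (radial x 'e_k j +i* angular x 'e_k j)%C.

Lemma dz_dparam x w j :
  dz j (dparam x w) = (radial x w j +i* angular x w j)%C * (param x 0 j +i* param x 1 j)%C.
Proof. by rewrite /dz !mxE. Qed.

(** Multiplication by [T] replaces columns [p] and [q] by the sum of all columns and by their sum
    weighted with the a_j. A row k other than [p] and [q] moves only angles, within the two
    constraints, so both new columns vanish there and the row becomes i e_k. The remaining 2 x 2
    block is triangular with diagonal m and [sqlogder] (v - i A). *)
Lemma det_frame_mx x : dom x -> \det (frame_mx x) =
  'i%C ^+ (m - 2) * (m%:R * sqlogder (u (x 0 q)) / (ar q - ar p))%:C%C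
   * (cosmom (x 0 q) -i* sinmom)%C.
Proof.
move=> Ix.
pose T : 'M[R[i]]_m := \matrix_(i, j)
  ((if j == p then 1 else if j == q then ar i else (i == j)%:R) %:C)%C.
have qp : q != p by rewrite eq_sym pq.
have dT : \det T = (ar q - ar p)%:C%C.
  rewrite -det_tr (det_two_rows pq); last first.
    by move=> k j kp kq jk; rewrite !mxE (negbTE kp) (negbTE kq) (negbTE jk).
  rewrite big1 ?mulr1; last first.
    by move=> k /andP[kp kq]; rewrite !mxE (negbTE kp) (negbTE kq) eqxx.
  by rewrite !mxE !eqxx (negbTE qp) -!rmorphM -rmorphB /= !mul1r.
have colp k : (frame_mx x *m T) k p =
    ((\sum_j radial x 'e_k j) +i* (\sum_j angular x 'e_k j))%C.
  rewrite mxE -sum_complex; apply: eq_bigr => j _.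
  by rewrite !mxE eqxx mulr1.
have colq k : (frame_mx x *m T) k q =
    ((\sum_j ar j * radial x 'e_k j) +i* (\sum_j ar j * angular x 'e_k j))%C.
  rewrite mxE -sum_complex; apply: eq_bigr => j _.
  rewrite !mxE (negbTE qp) eqxx; apply/eqP; rewrite eq_complex /=.
  by apply/andP; split; apply/eqP; ring.
have colj k j : j != p -> j != q ->
    (frame_mx x *m T) k j = (radial x 'e_k j +i* angular x 'e_k j)%C.
  move=> jp jq; rewrite mxE (bigD1 j) //= big1 ?addr0; last first.
    by move=> i ij; rewrite !mxE (negbTE jp) (negbTE jq) (negbTE ij) mulr0.
  by rewrite !mxE (negbTE jp) (negbTE jq) eqxx mulr1.
have ekp k : k != p -> ('e_k : 'rV[R]_m) 0 p = 0.
  by move=> kp; rewrite unit_rowE eq_sym (negbTE kp).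
have ekq k : k != q -> ('e_k : 'rV[R]_m) 0 q = 0.
  by move=> kq; rewrite unit_rowE eq_sym (negbTE kq).
have epp : ('e_p : 'rV[R]_m) 0 p = 1 by rewrite unit_rowE eqxx.
have eqq : ('e_q : 'rV[R]_m) 0 q = 1 by rewrite unit_rowE eqxx.
have rows k j : k != p -> k != q -> j != p -> j != q ->
    (frame_mx x *m T) k j = (0 +i* (j == k)%:R)%C.
  move=> kp kq jp jq; rewrite colj // /radial ekp // ekq // mul0r addr0.
  have [c0 d0] := coef_off jp jq.
  by rewrite /angular c0 d0 !mul0r !addr0 unit_rowE.
have dMT : \det (frame_mx x *m T) =
    m%:R%:C%C * (cosmom (x 0 q) * sqlogder (u (x 0 q)) -i* (sinmom * sqlogder (u (x 0 q))))%C
    * 'i%C ^+ (m - 2).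
  rewrite (det_two_rows pq); last first.
    move=> k j kp kq jk; case: (eqVneq j p) => [->|jp].
      by rewrite colp sum_radial sum_angular ekp // ekq // mulr0 !mul0r addr0.
    case: (eqVneq j q) => [->|jq].
      by rewrite colq sum_ar_radial sum_ar_angular ekq // !mul0r.
    by rewrite rows // (negbTE jk).
  congr (_ * _).
  - rewrite (colp p) (colq q) (colq p) sum_radial sum_angular !sum_ar_radial !sum_ar_angular.
    rewrite epp eqq (ekq p pq) !mul0r !mul1r addr0 mulr1.
    by rewrite subr0 mulNr.
  - transitivity (\prod_(k < m | (k != p) && (k != q)) ('i%C : R[i])).
      by apply: eq_bigr => k /andP[kp kq]; rewrite rows // eqxx.
    rewrite prodr_const; congr (_ ^+ _).
    have <- : #|[set k : 'I_m | (k != p) && (k != q)]%SET|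
        = #|[pred k | (k != p) && (k != q)]|.
      by apply: eq_card => k; rewrite inE.
    have -> : [set k : 'I_m | (k != p) && (k != q)]%SET = (~: [set p; q])%SET.
      by apply/setP => k; rewrite !inE negb_or.
    by rewrite cardsCs finset.setCK cards2 pq card_ord.
have D0 : (ar q - ar p)%:C%C != 0 :> R[i].
  by rewrite eq_complex /= eqxx andbT gt_eqF //; exact: ar_pq.
have d0 : ar q - ar p != 0 by rewrite gt_eqF //; exact: ar_pq.
have e : m%:R%:C%C * (cosmom (x 0 q) * sqlogder (u (x 0 q))
      -i* (sinmom * sqlogder (u (x 0 q))))%C =
    (m%:R * sqlogder (u (x 0 q)) / (ar q - ar p))%:C%C * (cosmom (x 0 q) -i* sinmom)%C
    * (ar q - ar p)%:C%C.
  by apply/eqP; rewrite eq_complex /=; apply/andP; split; apply/eqP; field; exact: d0.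
by apply: (mulIf D0); rewrite -{1}dT -det_mulmx dMT e; ring.
Qed.

(** v - i A is sqrt Q e^(-i th), while the product of the z_j has argument th, the sum of the
    angles. These phases cancel and only i^(m-2) survives. *)
Lemma Omega_param x : dom x -> exists2 D : R, 0 < D &
  Omega (partial param x) = 'i%C ^+ (m - 2) * D%:C%C.
Proof.
move=> Ix; pose t := x 0 q; pose r j := expR (x 0 p) * Num.sqrt (ar j * u t + 1).
exists (m%:R * sqlogder (u t) / (ar q - ar p) * (Num.sqrt (Qpoly a (u t)) * \prod_j r j)).
  have m0 : (0 < m)%N by case: (m) p => // -[].
  rewrite mulr_gt0 //.
    by rewrite divr_gt0 ?ar_pq // mulr_gt0 ?ltr0n // sqlogder_gt0.
  rewrite mulr_gt0 ?sqrtr_gt0 ?Qpoly_gt0 //; apply: prodr_gt0 => j _.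
  by rewrite mulr_gt0 ?expR_gt0 // sqrtr_gt0; exact: hpos.
have -> : Omega (partial param x) =
    \det (frame_mx x *m diag_mx (\row_j (param x 0 j +i* param x 1 j)%C)).
  congr (\det _); apply/matrixP => k j.
  rewrite mul_mx_diag [LHS]mxE [RHS]mxE partial_param // dz_dparam.
  by congr (_ * _); rewrite [RHS]mxE.
rewrite det_mulmx det_diag det_frame_mx //.
rewrite (eq_bigr (fun j => (r j * cos (angle x j) +i* (r j * sin (angle x j)))%C));
  last first.
  by move=> j _; rewrite mxE param0 param1.
rewrite prod_polar sum_angle -/t -[LHS]mulrA -[LHS]mulrA; congr (_ * _).
rewrite [in RHS]rmorphM; congr (_ * _).
have := cos2Dsin2 (th t) => c1.
rewrite -(sinmomE Ix) /cosmom -/t; set Q := Num.sqrt _; set W := \prod_j _.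
apply/eqP; rewrite eq_complex /=; apply/andP; split; apply/eqP; last by ring.
transitivity (Q * W * (cos (th t) ^+ 2 + sin (th t) ^+ 2)); first by ring.
by rewrite c1 mulr1.
Qed.

(** The frame is Lagrangian, so its volume is |Omega| = D; the conjugate phase times Omega is D as
    well. *)
Lemma param_calibrated x : dom x ->
  calib ('i%C ^+ (m - 2)) (partial param x) = vol_frame (partial param x).
Proof.
move=> Ix; have [D D0 eO] := Omega_param Ix.
have V : (vol_frame (partial param x))%:C%C = `|Omega (partial param x)|.
  apply: lagrangian_vol_frame => k l; rewrite !partial_param //.
  exact: param_lagrangian.
have n1 : `|'i%C ^+ (m - 2)| = 1 :> R[i] by rewrite normrX normc_i expr1n.
have {V} : (vol_frame (partial param x))%:C%C = D%:C%C.
  by rewrite V eO normrM n1 mul1r ger0_norm // ler0c ltW.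
move=> /complexI ->; rewrite /calib Re_conj_mul eO mulrA.
by rewrite [X in complex.Re (X * _)]mulrC -sqr_normc n1 expr1n mul1r.
Qed.

Lemma param_immersion x : dom x -> forall c : 'I_m -> R,
  \sum_(k < m) c k *: partial param x k = 0 -> forall k, c k = 0.
Proof.
move=> Ix; apply: Omega_neq0_free; have [D D0 ->] := Omega_param Ix.
rewrite mulf_neq0 // ?expf_neq0 //.
- by rewrite eq_complex /= oner_eq0 andbF.
- by rewrite eq_complex /= gt_eqF.
Qed.

(** * Local inverse and charts *)

Lemma cont_param x : dom x -> {for x, continuous param}.
Proof.
move=> Ix; have [_] := param_smooth [::].
by rewrite (continuous_open_subspace _ dom_open) => /(_ x (mem_set Ix)).
Qed.

(** * Coordinates read off from a point of N *)

Implicit Types P : 'M[R]_(2, m).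

Definition modsq P j : R := P 0 j ^+ 2 + P 1 j ^+ 2.
(** On N the squared modulus of z_j is r^2 (a_j u + 1); since the a_j sum to 0, the mean is r^2. *)
Definition radsq P : R := (\sum_(j < m) modsq P j) / m%:R.
Definition get_logr P : R := ln (radsq P) / 2.
Definition get_u P : R := (modsq P q / radsq P - 1) / ar q.
(** [get_sin] and [get_cos] are the sine and cosine of arg z_j - [al], written so as to be
    continuous where z_j is nonzero. *)
Definition get_sin (al : R) P j : R :=
  (P 1 j * cos al - P 0 j * sin al) / Num.sqrt (modsq P j).
Definition get_cos (al : R) P j : R :=
  (P 0 j * cos al + P 1 j * sin al) / Num.sqrt (modsq P j).

Lemma ar_q_neq0 : ar q != 0.
Proof. by rewrite intr_eq0 gt_eqF. Qed.

Lemma m_neq0 : m%:R != 0 :> R.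
Proof. by rewrite pnatr_eq0; case: (m) p => // -[]. Qed.

Lemma modsq_gt0 x j : dom x -> 0 < modsq (param x) j.
Proof.
by move=> Ix; rewrite /modsq param_norm // mulr_gt0 ?exprn_gt0 ?expR_gt0 //; exact: hpos.
Qed.

Lemma radsqE x : dom x -> radsq (param x) = expR (x 0 p) ^+ 2.
Proof.
move=> Ix; rewrite /radsq; under eq_bigr do rewrite /modsq param_norm //.
rewrite -mulr_sumr big_split /= -mulr_suml ar_sum mul0r add0r sumr_const card_ord.
by rewrite mulfK // m_neq0.
Qed.

Lemma get_logrE x : dom x -> get_logr (param x) = x 0 p.
Proof.
move=> Ix; rewrite /get_logr radsqE // lnXn ?expR_gt0 // expRK.
by rewrite -[x 0 p *+ 2]mulr_natr mulfK.
Qed.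

Lemma get_uE x : dom x -> get_u (param x) = u (x 0 q).
Proof.
move=> Ix; rewrite /get_u radsqE // /modsq param_norm //.
have e0 : expR (x 0 p) != 0 by rewrite gt_eqF ?expR_gt0.
by field; rewrite e0 ar_q_neq0.
Qed.

Lemma sqrt_modsq x j : dom x -> Num.sqrt (modsq (param x) j) =
  expR (x 0 p) * Num.sqrt (ar j * u (x 0 q) + 1).
Proof.
move=> Ix; rewrite /modsq param_norm // sqrtrM ?sqr_ge0 // sqrtr_sqr gtr0_norm //.
exact: expR_gt0.
Qed.

Lemma get_sinE al x j : dom x -> get_sin al (param x) j = sin (angle x j - al).
Proof.
move=> Ix; rewrite /get_sin sqrt_modsq // param0 param1 sinB.
have e0 : expR (x 0 p) != 0 by rewrite gt_eqF ?expR_gt0.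
have s0 : Num.sqrt (ar j * u (x 0 q) + 1) != 0.
  by rewrite gt_eqF // sqrtr_gt0; exact: hpos.
by field; rewrite e0 s0.
Qed.

Lemma get_cosE al x j : dom x -> get_cos al (param x) j = cos (angle x j - al).
Proof.
move=> Ix; rewrite /get_cos sqrt_modsq // param0 param1 cosB.
have e0 : expR (x 0 p) != 0 by rewrite gt_eqF ?expR_gt0.
have s0 : Num.sqrt (ar j * u (x 0 q) + 1) != 0.
  by rewrite gt_eqF // sqrtr_gt0; exact: hpos.
by field; rewrite e0 s0.
Qed.

Lemma cont_entry P (s : 'I_2) j : {for P, continuous (fun P' : 'M[R]_(2, m) => P' s j)}.
Proof. exact: coord_continuous. Qed.

Lemma cont_modsq P j : {for P, continuous (fun P' => modsq P' j)}.
Proof. by apply: continuousD; apply: continuousM; exact: cont_entry. Qed.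

Lemma cont_radsq P : {for P, continuous radsq}.
Proof.
apply: continuousM; last exact: cst_continuous.
by apply: continuous_bigsum => j; exact: cont_modsq.
Qed.

Section AtPoint.
Variable x0 : 'rV[R]_m.
Hypothesis I0x : dom x0.
Let P0 := param x0.

Lemma cont_get_logr : {for P0, continuous get_logr}.
Proof.
apply: continuousM; last exact: cst_continuous.
apply: (@continuous_comp _ _ _ radsq (@ln R)); first exact: cont_radsq.
by apply: continuous_ln; rewrite radsqE // exprn_gt0 // expR_gt0.
Qed.

Lemma cont_get_u : {for P0, continuous get_u}.
Proof.
apply: continuousM; last exact: cst_continuous.
apply: continuousB; last exact: cst_continuous.
apply: continuousM; first exact: cont_modsq.
apply: continuousV; last exact: cont_radsq.
by rewrite radsqE // gt_eqF // exprn_gt0 // expR_gt0.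
Qed.

Lemma cont_inv_sqrt_modsq j : {for P0, continuous (fun P => (Num.sqrt (modsq P j))^-1)}.
Proof.
apply: (@continuousV _ _ (fun P => Num.sqrt (modsq P j))).
  by rewrite gt_eqF // sqrtr_gt0; exact: modsq_gt0.
apply: (@continuous_comp _ _ _ (fun P => modsq P j) Num.sqrt); first exact: cont_modsq.
exact: sqrt_continuous.
Qed.

Lemma cont_get_sin al j : {for P0, continuous (fun P => get_sin al P j)}.
Proof.
apply: continuousM; last exact: cont_inv_sqrt_modsq.
by apply: continuousB; apply: continuousM; (exact: cont_entry || exact: cst_continuous).
Qed.

Lemma cont_get_cos al j : {for P0, continuous (fun P => get_cos al P j)}.
Proof.
apply: continuousM; last exact: cont_inv_sqrt_modsq.
by apply: continuousD; apply: continuousM; (exact: cont_entry || exact: cst_continuous).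
Qed.

(** A continuous branch of arg z_j minus its value at [x0]; it is the true displacement modulo 2 pi
    where the cosine is positive. *)
Definition get_dang P j : R := asin (get_sin (angle x0 j) P j).

Lemma get_dang0 j : get_dang P0 j = 0.
Proof.
rewrite /get_dang get_sinE // subrr sin0 -{2}(@sinK R 0) ?sin0 //.
have := @pi_gt0 R; rewrite in_itv /= => pi0; apply/andP; split; lra.
Qed.

Lemma cont_get_dang j : {for P0, continuous (fun P => get_dang P j)}.
Proof.
apply: (@continuous_comp _ _ _ (fun P => get_sin (angle x0 j) P j) asin).
  exact: cont_get_sin.
by apply: continuous_asin; rewrite get_sinE // subrr sin0 ltrN10 ltr01.
Qed.

Lemma get_dangE x j : dom x -> 0 < get_cos (angle x0 j) (param x) j ->
  eqang (get_dang (param x) j) (angle x j - angle x0 j).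
Proof.
move=> Ix; rewrite get_cosE // => c0; rewrite /get_dang get_sinE //.
set b := angle x j - _ in c0 *.
have s1 : -1 <= sin b <= 1 by rewrite sin_geN1 sin_le1.
split; last by rewrite asinK // in_itv.
by rewrite cos_asin // -cos2sin2 sqrtr_sqr gtr0_norm.
Qed.

(** The gap to the time of [x0], expressed through the point [P] alone. Its continuity at [P0] makes
    the gap small for nearby points of N, whatever time they were produced at. *)
Definition get_gap P : R :=
  (get_u P - u (x0 0 q)) ^+ 2
  + (Num.sqrt (Qpoly a (get_u P)) * cos (th (x0 0 q) + \sum_j get_dang P j)
     - cosmom (x0 0 q)) ^+ 2
  + 2 * (1 - cos (\sum_j ar j * get_dang P j)).

Lemma get_gap0 : get_gap P0 = 0.
Proof.
rewrite /get_gap get_uE // big1 ?addr0; last by move=> j _; exact: get_dang0.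
rewrite big1 => [|j _]; last by rewrite get_dang0 mulr0.
by rewrite -/(cosmom _) !subrr cos0 subrr expr0n /= mulr0 !addr0.
Qed.

Lemma cont_sum_dang : {for P0, continuous (fun P => \sum_j get_dang P j)}.
Proof. by apply: continuous_bigsum => j; exact: cont_get_dang. Qed.

Lemma cont_sum_ar_dang : {for P0, continuous (fun P => \sum_j ar j * get_dang P j)}.
Proof.
apply: continuous_bigsum => j; apply: continuousM; first exact: cst_continuous.
exact: cont_get_dang.
Qed.

Lemma cont_get_gap : {for P0, continuous get_gap}.
Proof.
apply: continuousD; first apply: continuousD.
- have c : {for P0, continuous (fun P => get_u P - u (x0 0 q))}.
    by apply: continuousB; [exact: cont_get_u|exact: cst_continuous].
  exact: continuousM.
- have c : {for P0, continuous (fun P => Num.sqrt (Qpoly a (get_u P))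
      * cos (th (x0 0 q) + \sum_j get_dang P j) - cosmom (x0 0 q))}.
    apply: continuousB; last exact: cst_continuous.
    apply: continuousM.
      apply: (@continuous_comp _ _ _ (fun P => Qpoly a (get_u P)) Num.sqrt);
        last exact: sqrt_continuous.
      apply: continuous_bigprod => j; apply: continuousD; last exact: cst_continuous.
      by apply: continuousM; [exact: cst_continuous|exact: cont_get_u].
    apply: (@continuous_comp _ _ _ (fun P => th (x0 0 q) + \sum_j get_dang P j) cos).
      by apply: continuousD; [exact: cst_continuous|exact: cont_sum_dang].
    exact: continuous_cos.
  exact: continuousM.
- apply: continuousM; first exact: cst_continuous.
  apply: continuousB; first exact: cst_continuous.
  apply: (@continuous_comp _ _ _ (fun P => \sum_j ar j * get_dang P j) cos).
    exact: cont_sum_ar_dang.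
  exact: continuous_cos.
Qed.

Lemma get_gapE x : dom x -> (forall j, 0 < get_cos (angle x0 j) (param x) j) ->
  gap (x 0 q) (x0 0 q) = get_gap (param x).
Proof.
move=> Ix c0; rewrite /gap /get_gap get_uE //; congr (_ + (_ - _) ^+ 2 + 2 * (1 - _)).
- rewrite /cosmom; congr (_ * _).
  rewrite -(sum_angle x) -(sum_angle x0) -big_split /=.
  have [//] : eqang (\sum_j angle x j) (\sum_j (angle x0 j + get_dang (param x) j)).
  apply: eqang_sum => j; apply: eqang_sym.
  have := eqangD (eqang_refl (angle x0 j)) (get_dangE Ix (c0 j)).
  by rewrite [X in eqang _ X]addrC subrK.
- have : eqang (ps (x 0 q) - ps (x0 0 q)) (\sum_j ar j * get_dang (param x) j).
    rewrite -(sum_ar_angle x) -(sum_ar_angle x0) -sumrB.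
    apply: eqang_sum => j; rewrite -mulrBr; apply: eqangMz; apply: eqang_sym.
    exact: get_dangE.
  by case.
Qed.

Lemma near_cont (f : 'M[R]_(2, m) -> R) (c e : R) : {for P0, continuous f} ->
  f P0 = c -> 0 < e -> \forall P \near P0, `|f P - c| < e.
Proof.
move=> cf <- e0; have /cvgrPdist_lt/(_ e e0) := cf.
by apply: filterS => P; rewrite distrC.
Qed.

(** A point of N near [P0] may come from a remote [x]; [curve_return] replaces its time by one near
    that of [x0], and the angles are replaced by their representatives near those of [x0]. *)
Lemma param_open (U : set 'rV[R]_m) : nbhs x0 U ->
  \forall P \near P0, forall x, dom x -> P = param x ->
    exists x', [/\ dom x', U x' & param x' = P].
Proof.
move=> nU; set t0 := x0 0 q.
have [e e0 He] : exists2 e : R, 0 < e & forall y : 'rV[R]_m,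
    (forall k, `|y 0 k - x0 0 k| < e) -> U y.
  have /nbhs_ballP[e /= e0 be] := nU; exists e => // y H; apply: be.
  by split => // i j; rewrite ord1 /ball /= distrC.
have [d1 d10 Hth] : exists2 d : R, 0 < d & forall t, `|t - t0| < d -> `|th t - th t0| < 1.
  have /cvgrPdist_lt/(_ 1 ltr01)/nbhs_ballP[d /= d0 H] := cont_th I0x.
  by exists d => // t td; rewrite distrC; apply: H; rewrite /ball /= distrC.
have [d2 d20 Hps] : exists2 d : R, 0 < d & forall t, `|t - t0| < d -> `|ps t - ps t0| < 1.
  have /cvgrPdist_lt/(_ 1 ltr01)/nbhs_ballP[d /= d0 H] := cont_ps I0x.
  by exists d => // t td; rewrite distrC; apply: H; rewrite /ball /= distrC.
pose d := Num.min e (Num.min d1 d2).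
have d0 : 0 < d by rewrite !lt_min e0 d10.
have [eta eta0 Hret] := curve_return I0x d0.
have n1 := near_cont cont_get_logr (get_logrE I0x) e0.
have n2 : \forall P \near P0, forall j, `|get_dang P j - 0| < e.
  apply: (@filter_forall _ _ (fun j P => `|get_dang P j - 0| < e) (nbhs P0) _) => j.
  exact: near_cont (@cont_get_dang j) (get_dang0 j) e0.
have n3 : \forall P \near P0, forall j, `|get_cos (angle x0 j) P j - 1| < 1.
  apply: (@filter_forall _ _
    (fun j P => `|get_cos (angle x0 j) P j - 1| < 1) (nbhs P0) _) => j.
  apply: near_cont => //; first exact: cont_get_cos.
  by rewrite get_cosE // subrr cos0.
have n4 : \forall P \near P0, `|\sum_j get_dang P j - 0| < 1.
  apply: near_cont => //; first exact: cont_sum_dang.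
  by rewrite big1 // => j _; exact: get_dang0.
have n5 : \forall P \near P0, `|\sum_j ar j * get_dang P j - 0| < 1.
  apply: near_cont => //; first exact: cont_sum_ar_dang.
  by rewrite big1 // => j _; rewrite get_dang0 mulr0.
have n6 := near_cont cont_get_gap get_gap0 eta0.
near=> P => x Ix eP.
have h1 : `|get_logr P - x0 0 p| < e by near: P.
have h2 j : `|get_dang P j - 0| < e by move: j; near: P.
have h3 j : `|get_cos (angle x0 j) P j - 1| < 1 by move: j; near: P.
have h4 : `|\sum_j get_dang P j - 0| < 1 by near: P.
have h5 : `|\sum_j ar j * get_dang P j - 0| < 1 by near: P.
have h6 : `|get_gap P - 0| < eta by near: P.
move: h1 h2 h3 h4 h5 h6; rewrite eP => h1 h2 h3 h4 h5 h6.
have c0 j : 0 < get_cos (angle x0 j) (param x) j.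
  by have := h3 j; rewrite ltr_norml => /andP[]; lra.
have gl : gap (x 0 q) t0 < eta.
  by rewrite get_gapE //; move: h6; rewrite subr0; apply: le_lt_trans; exact: ler_norm.
have [t' [It' td /gap_eq0[ut vt pt]]] := Hret _ Ix gl.
move: td; rewrite !lt_min => /and3P[te t1 t2].
set de := get_dang (param x) in h2 h4 h5.
have eqa j : eqang (angle x0 j + de j) (angle x j).
  have := eqangD (eqang_refl (angle x0 j)) (get_dangE Ix (c0 j)).
  by rewrite [X in eqang _ X]addrC subrK.
(* Both sides are congruent modulo 2 pi and each lies within 1 of [th t0], so [eqang_close] makes
   them equal. The same holds for [ps] below. *)
have sth : \sum_j (angle x0 j + de j) = th t'.
  apply: eqang_close.
    apply: eqang_trans (eqang_mom Ix It' ut vt); rewrite -(sum_angle x).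
    exact: eqang_sum.
  rewrite big_split /= sum_angle -/t0 addrAC.
  apply: (le_trans (ler_normD _ _)); have := Hth _ t1; rewrite distrC.
  by move: h4; rewrite subr0 => *; lra.
have sps : \sum_j ar j * (angle x0 j + de j) = ps t'.
  apply: eqang_close.
    apply: eqang_trans pt; rewrite -(sum_ar_angle x).
    by apply: eqang_sum => j; exact: eqangMz.
  under eq_bigr do rewrite mulrDr.
  rewrite big_split /= sum_ar_angle -/t0 addrAC.
  apply: (le_trans (ler_normD _ _)); have := Hps _ t2; rewrite distrC.
  by move: h5; rewrite subr0 => *; lra.
pose x' : 'rV[R]_m := \row_k (if k == p then x 0 p else if k == q then t'
  else angle x0 k + de k).
have xp : x' 0 p = x 0 p by rewrite mxE eqxx.
have xq : x' 0 q = t' by rewrite mxE eq_sym (negbTE pq) eqxx.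
have ang' : angle x' =1 (fun j => angle x0 j + de j).
  apply: angle_unique; rewrite ?xq // => j /negbTE jp /negbTE jq.
  by rewrite mxE jp jq.
exists x'; split; first by rewrite /dom /= xq.
- apply: He => k; rewrite mxE; case: (eqVneq k p) => [->|kp].
    by rewrite -(get_logrE Ix).
  case: (eqVneq k q) => [->//|kq].
  by rewrite angle_off // addrAC subrr add0r -[de k]subr0.
- apply/matrixP => s j; rewrite [LHS]mxE [RHS]mxE xp xq -ut ang'.
  by have [-> ->] := eqa j.
Unshelve. all: by end_near. Qed.

Lemma near_dom_angle : \forall x \near x0, dom x /\
  forall j, `|angle x j - angle x0 j| < 1.
Proof.
apply: filterI; first exact: (open_nbhs_nbhs (conj dom_open I0x)).
apply: (@filter_forall _ _ (fun j x => `|angle x j - angle x0 j| < 1) (nbhs x0) _) => j.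
have /cvgrPdist_lt/(_ 1 ltr01) := @cont_angle x0 I0x j.
by apply: filterS => x; rewrite distrC.
Qed.

(** Equal points have congruent angles; both being within 1 of the angle at [x0], they are equal as
    reals, so [curve_inj] recovers the time. *)
Lemma param_inj_near x y : dom x -> dom y ->
  (forall j, `|angle x j - angle x0 j| < 1) ->
  (forall j, `|angle y j - angle x0 j| < 1) ->
  param x = param y -> x = y.
Proof.
move=> Ix Iy ax ay e.
have ea j : angle x j = angle y j.
  apply: eqang_close.
    have sj := get_sinE 0 j Ix; have cj := get_cosE 0 j Ix.
    rewrite e get_sinE // subr0 in sj; rewrite e get_cosE // subr0 in cj.
    by rewrite !subr0 in sj cj; split.
  have := ax j; have := ay j; rewrite distrC => h1 h2.
  have -> : angle x j - angle y j = (angle x j - angle x0 j) + (angle x0 j - angle y j) by ring.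
  by apply: (le_trans (ler_normD _ _)); lra.
have eq_ : x 0 q = y 0 q.
  apply: curve_inj => //.
  - by rewrite -(get_uE Ix) -(get_uE Iy) e.
  - by rewrite -(sum_ar_angle x) -(sum_ar_angle y); apply: eq_bigr => j _; rewrite ea.
apply/rowP => k; case: (eqVneq k p) => [->|kp].
  by rewrite -(get_logrE Ix) -(get_logrE Iy) e.
case: (eqVneq k q) => [->//|kq].
by rewrite -(angle_off x kp kq) -(angle_off y kp kq).
Qed.

End AtPoint.

Lemma param_chart x0 : dom x0 -> exists U : set 'rV[R]_m,
  [/\ U x0, U `<=` dom & chart (param @` dom) U param].
Proof.
move=> I0x; have := near_dom_angle I0x => /nbhs_interior nB.
set B := interior _ in nB.
have BP x : B x -> dom x /\ forall j, `|angle x j - angle x0 j| < 1.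
  by move=> /interior_subset.
have oB : open B by exact: open_interior.
have := param_open I0x nB => /nbhs_interior nW.
set W := interior _ in nW.
have oW : open W by exact: open_interior.
have WP P : W P -> forall x, dom x -> P = param x ->
    exists x', [/\ dom x', B x' & param x' = P] by move=> /interior_subset.
(* Intersecting with the preimage of [W] makes the image exactly N [&] W: by [WP], each point of N
   in [W] has a parameter in [B]. *)
pose U := B `&` param @^-1` W.
have Udom : U `<=` dom by move=> x [/BP[]].
have oU : open U.
  rewrite openE => x [Bx Wx]; have Ix := (BP x Bx).1.
  apply: filterI; first exact: (open_nbhs_nbhs (conj oB Bx)).
  exact: (cont_param Ix (open_nbhs_nbhs (conj oW Wx))).
have injU x y : U x -> U y -> param x = param y -> x = y.
  by move=> [/BP[Ix ax] _] [/BP[Iy ay] _]; exact: param_inj_near.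
exists U; split => //; first by split; [exact: nbhs_singleton nB|exact: nbhs_singleton nW].
split.
- split => // vs; have [d c] := param_smooth vs; split.
    by move=> x /Udom; exact: d.
  exact: continuous_subspaceW c.
- by move=> x /Udom; exact: param_immersion.
- exact: injU.
- exists W => //; apply/seteqP; split => [P [x Ux <-]|P [[x Ix <-] Wx]].
    by split; [exists x => //; exact: Udom|case: Ux].
  have [x' [Ix' Bx' ex']] := WP _ Wx x Ix erefl.
  by exists x' => //; split => //=; rewrite ex'.
(* The inverse by choice; 0 is the default value off the image of [U]. *)
- pose g P : 'rV[R]_m := xget 0 [set x | U x /\ param x = P].
  have gK x : U x -> g (param x) = x.
    move=> Ux; have [] := @xgetPex _ 0 [set y | U y /\ param y = param x]
      (ex_intro _ x (conj Ux erefl)).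
    by move=> Ug eg; exact: injU.
  exists g; split => //.
  apply/subspace_continuousP => P [x1 Ux1 <-] V nV.
  have {}nV : nbhs x1 V by rewrite -(gK x1 Ux1).
  have nU1 : nbhs x1 (V `&` U).
    by apply: filterI => //; exact: (open_nbhs_nbhs (conj oU Ux1)).
  (* Continuity of the inverse is openness of [param] at x1: nearby points of the image have a
     parameter in both [V] and [U], and injectivity on [U] identifies it with the value of [g]. *)
  have := param_open (Udom _ Ux1) nU1.
  apply: filterS => P' HP [x Ux exP].
  have [x' [Ix' [Vx' Ux'] ex']] := HP x (Udom _ Ux) (esym exP).
  have eg : g P' = x' by rewrite -ex'; exact: gK.
  by rewrite -eg in Vx'.
Qed.

Lemma param_same_orientation x x' : dom x -> dom x' -> param x = param x' ->
  same_orientation (partial param x) (partial param x').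
Proof.
(* The two frames are equal, since u, v and the entries of [param] are determined by the common
   point; hence the identity transition matrix. *)
move=> Ix Ix' e; exists 1%:M; split; last by rewrite det1 ltr01.
have eu : u (x 0 q) = u (x' 0 q) by rewrite -(get_uE Ix) -(get_uE Ix') e.
have ev : cosmom (x 0 q) = cosmom (x' 0 q).
  rewrite /cosmom eu; congr (_ * _).
  have : eqang (th (x 0 q)) (th (x' 0 q)); last by case.
  rewrite -(sum_angle x) -(sum_angle x'); apply: eqang_sum => j.
  have sj := get_sinE 0 j Ix; have cj := get_cosE 0 j Ix.
  rewrite e get_sinE // in sj; rewrite e get_cosE // in cj.
  by rewrite !subr0 in sj cj; split.
move=> k; rewrite (bigD1 k) //= mxE eqxx scale1r big1 ?addr0; last first.
  by move=> l /negbTE lk; rewrite mxE eq_sym lk scale0r.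
by rewrite !partial_param // /dparam /radial /angular e eu ev.
Qed.

Lemma image_special_lagrangian :
  special_lagrangian ('i%C ^+ (m - 2)) (param @` dom).
Proof.
split.
  apply: (@complexI R); rewrite rmorphD !rmorphXn /= -!rmorphXn -rmorphD /=.
  by rewrite add_Re2_Im2 normrX normc_i !expr1n.
have ch (i : {x | dom x}) := cid (param_chart (svalP i)).
(* One chart around each parameter; all share the map [param] and differ only in their domains. *)
exists {x | dom x}, (fun i => sval (ch i)), (fun=> param); split.
- by move=> i; case: (svalP (ch i)).
- move=> P [x Ix <-]; exists (exist _ x Ix), x => //.
  by case: (svalP (ch (exist _ x Ix))).
- move=> i i' x x' Ux Ux' e; apply: param_same_orientation => //.
  + by case: (svalP (ch i)) => _ + _; apply.
  + by case: (svalP (ch i')) => _ + _; apply.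
- move=> i x Ux; apply: param_calibrated.
  by case: (svalP (ch i)) => _ + _; apply.
Qed.

End Flow.

Theorem theorem7p2 (R : realType) (m : nat) (a : 'I_m -> int)
  (eps : R) (u th ps : R -> R) :
  (3 <= m)%N ->
  (forall i j : 'I_m, (i <= j)%N -> a i <= a j) ->
  (exists j, a j != 0) ->
  (\big[gcdn/0%N]_(j < m) `|a j|%N = 1%N) ->
  \sum_(j < m) a j = 0 ->
  0 < eps ->
  (forall t, -eps < t < eps ->
     [/\ derivable u t 1, derivable th t 1 & derivable ps t 1]) ->
  (forall t, -eps < t < eps -> forall j, 0 < (a j)%:~R * u t + 1) ->
  (forall t, -eps < t < eps ->
     derive1 u t = 2 * Num.sqrt (Qpoly a (u t)) * cos (th t)) ->
  (forall t, -eps < t < eps ->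
     derive1 th t = - Num.sqrt (Qpoly a (u t)) * sin (th t)
                  * \sum_(j < m) ((a j)%:~R / ((a j)%:~R * u t + 1))) ->
  (forall t, -eps < t < eps ->
     derive1 ps t = - Num.sqrt (Qpoly a (u t)) * sin (th t)
                  * \sum_(j < m) ((a j)%:~R ^+ 2 / ((a j)%:~R * u t + 1))) ->
  special_lagrangian ('i%C ^+ (m - 2))
    [set P : 'M[R]_(2, m) | exists (r t : R) (al : 'I_m -> R),
        [/\ 0 < r, -eps < t < eps,
            \sum_(j < m) al j = th t,
            \sum_(j < m) (a j)%:~R * al j = ps t &
            P = Npoint a r (u t) al]].
Proof.
move=> _ _ a0 _ asum eps0 hder hpos hu hth hps.
(* If no a_j were negative, the zero sum would force all of them to be 0; the same argument for the
   opposites gives [q]. *)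
have [p ap] : exists p, a p < 0.
  apply: contrapT => /forallNP H.
  have ge0 j : 0 <= a j by rewrite leNgt; apply/negP; exact: H.
  case: a0 => j; have /eqP := asum; rewrite psumr_eq0 // => /allP /(_ j).
  by rewrite mem_index_enum implyTb => /(_ isT) ->.
have [q aq] : exists q, 0 < a q.
  apply: contrapT => /forallNP H.
  have le0 j : 0 <= - a j by rewrite oppr_ge0 leNgt; apply/negP; exact: H.
  case: a0 => j; have : \sum_j - a j == 0 by rewrite sumrN asum oppr0.
  rewrite psumr_eq0 // => /allP /(_ j).
  by rewrite mem_index_enum implyTb oppr_eq0 => /(_ isT) ->.
rewrite (image_param eps u th ps ap aq).
exact: image_special_lagrangian.
Qed.
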